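(* Let $X$ be a paracompact Hausdorff space and let $n<\omega$. The following are equivalent: (a) $\dim(X)\leq n$. (b) For each aspherical sequence $\varphi_k:X\leadsto Y$, $0\leq k\leq n$, of lower locally constant mappings in a Hausdorff space $Y$, the mapping $\varphi_n$ has a continuous selection. (c) Each sequence $\mathscr{U}_k$, $0\leq k\leq n$, of open covers of $X$ admits a canonical map $f:X\to|\Delta(\mathscr{U}_{\leq n})|$.
   Context: $\dim$ is the covering dimension. Set-valued mappings: $\Phi:X\leadsto Y$ is a map from $X$ to the nonempty subsets of $Y$; $f:X\to Y$ is a selection for $\Phi$ if $f(x)\in\Phi(x)$ for all $x$; $\Phi$ is lower locally constant if $\{x\in X:K\subset\Phi(x)\}$ is open in $X$ for every compact $K\subset Y$. For $S,B\subset Y$ and $k\ge0$, $S\stackrel{k}{\hookrightarrow}B$ means every continuous map from the $k$-sphere to $S$ extends to a continuous map from the $(k+1)$-ball to $B$; $\varphi\stackrel{k}{\hookrightarrow}\psi$ means $\varphi(x)\stackrel{k}{\hookrightarrow}\psi(x)$ for all $x\in X$. A finite sequence $\varphi_k:X\leadsto Y$, $0\leq k\leq n$, is aspherical if $\varphi_k\stackrel{k}{\hookrightarrow}\varphi_{k+1}$ for every $k<n$. Simplicial complexes: a simplicial complex is a collection $\Sigma$ of nonempty finite sets closed under taking nonempty subsets. Embedding the vertices as a linearly independent subset of a normed linear space, $|\sigma|$ is the convex hull of $\sigma\in\Sigma$, and $|\Sigma|=\bigcup_{\sigma\in\Sigma}|\sigma|$ is the geometric realisation with the Whitehead topology ($U$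 is open iff $U\cap|\sigma|$ is open in $|\sigma|$ for every $\sigma\in\Sigma$). $\langle\sigma\rangle$ is the relative interior of $|\sigma|$, and $\mathrm{st}\langle v\rangle=\bigcup_{v\in\sigma\in\Sigma}\langle\sigma\rangle$ is the open star of a vertex $v$. $\Delta(\mathscr{U}_{\leq n})$: regard the disjoint union $\bigcup_{k\leq n}\mathscr{U}_k\times\{k\}$ as an indexed cover of $X$, the index $(U,k)$ representing the set $U$. For a nonempty finite set $\sigma$ of indices, $\ker[\sigma]=\bigcap_{(U,k)\in\sigma}U$. The nerve $\mathscr{N}(\mathscr{U}_{\leq n})$ consists of all such $\sigma$ with $\ker[\sigma]\ne\varnothing$, and $\Delta(\mathscr{U}_{\leq n})$ is the subcomplex of those $\sigma$ containing at most one element of $\mathscr{U}_k\times\{k\}$ for each $k\leq n$. Canonical map: a continuous map $f:X\to|\Delta(\mathscr{U}_{\leq n})|\subset|\mathscr{N}(\mathscr{U}_{\leq n})|$ is canonical if $f^{-1}(\mathrm{st}\langle(U,k)\rangle)\subset U$ for every vertex $(U,k)$. *)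

(* Defs.v *)
From HB Require Import structures.
From mathcomp Require Import all_boot all_order all_algebra finmap.
From mathcomp Require Import all_classical all_reals all_analysis.

Set Implicit Arguments.
Unset Strict Implicit.
Unset Printing Implicit Defensive.

Import Order.TTheory GRing.Theory Num.Theory.
Import numFieldNormedType.Exports.

Local Open Scope classical_set_scope.
Local Open Scope card_scope.
Local Open Scope ring_scope.

Section Covers.
Variable X : topologicalType.
Implicit Types CC DD : set (set X).

Definition open_cover CC : Prop :=
  (forall U, CC U -> open U) /\ \bigcup_(U in CC) U = [set: X].

Definition refines DD CC : Prop :=
  forall V, DD V -> exists2 U, CC U & V `<=` U.

Definition locally_finite DD : Prop :=
  forall x : X, exists2 N, nbhs x N &
    finite_set [set V | DD V /\ V `&` N !=set0].

Definition paracompact : Prop :=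
  forall CC, open_cover CC ->
    exists DD, [/\ open_cover DD, refines DD CC & locally_finite DD].

(* The order of a family counts one less than the multiplicity: order at most
   n means that no point lies in more than n + 1 distinct members. *)
Definition order_le DD (n : nat) : Prop :=
  forall x : X, [set V | DD V /\ V x] #<= `I_n.+1.

(* Lebesgue covering dimension in the Cech form, with finite open covers. *)
Definition dim_le (n : nat) : Prop :=
  forall CC, open_cover CC -> finite_set CC ->
    exists DD, [/\ open_cover DD, finite_set DD, refines DD CC & order_le DD n].

End Covers.

Section SetValued.
Variables X Y : topologicalType.

Definition set_valued (Phi : X -> set Y) : Prop :=
  forall x, Phi x !=set0.

Definition selection (Phi : X -> set Y) (f : X -> Y) : Prop :=
  forall x, Phi x (f x).

Definition lower_locally_constant (Phi : X -> set Y) : Prop :=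
  forall K : set Y, compact K -> open [set x | K `<=` Phi x].

End SetValued.

Section Aspherical.
Variable R : realType.

Definition sphere (k : nat) : set 'rV[R]_k.+1 :=
  [set u | \sum_(i < k.+1) u 0 i ^+ 2 = 1].
Arguments sphere : clear implicits.

(* The ball bounded by [sphere k], hence of dimension k + 1. *)
Definition cball (k : nat) : set 'rV[R]_k.+1 :=
  [set u | \sum_(i < k.+1) u 0 i ^+ 2 <= 1].
Arguments cball : clear implicits.

Definition sphere_extends (Y : topologicalType) (k : nat) (S B : set Y) : Prop :=
  forall f : 'rV[R]_k.+1 -> Y,
    {within sphere k, continuous f} -> f @` sphere k `<=` S ->
    exists g : 'rV[R]_k.+1 -> Y,
      [/\ {within cball k, continuous g}, g @` cball k `<=` B &
          forall u, sphere k u -> g u = f u].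

(* Only the terms phi_0, ..., phi_n of phi are relevant. *)
Definition aspherical (X Y : topologicalType) (n : nat)
    (phi : nat -> X -> set Y) : Prop :=
  forall k, (k < n)%N -> forall x, sphere_extends k (phi k x) (phi k.+1 x).

End Aspherical.

Section Hulls.
Variable R : realType.

Definition convex_hull (E : lmodType R) (A : set E) : set E :=
  smallest (@convex_set R E) A.

Definition affine_set (E : lmodType R) (A : set E) : Prop :=
  forall (x y : E) (t : R), A x -> A y -> A ((1 - t) *: x + t *: y).

Definition affine_hull (E : lmodType R) (A : set E) : set E :=
  smallest (@affine_set E) A.

(* In [subspace H] the points outside H are isolated; this is harmless here, as
   A is contained in its affine hull. *)
Definition relint (E : normedModType R) (A : set E) : set E :=
  [set x | A x /\ (A : set (subspace (affine_hull A)))° x].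

End Hulls.

Section FreeNormed.
Variables (R : realType) (V : choiceType).

(* The finitely supported functions V -> R with the l1 norm: a normed space in
   which V embeds as the linearly independent set of indicator functions (see
   [vertex] and [vertex_independent]). The geometric realisation does not
   depend, up to homeomorphism, on this choice of embedding. *)
Definition finsupp_pred : {pred V -> R^o} :=
  fun t => `[< finite_set [set v | t v != 0] >].

Lemma finsupp_submod : submod_closed finsupp_pred.
Proof.
split=> [|a s t /asboolP fs /asboolP ft]; apply/asboolP.
  by apply: (sub_finite_set _ (@finite_set0 V)) => v /=; rewrite eqxx.
have: finite_set ([set v | s v != 0] `|` [set v | t v != 0]).
  by rewrite finite_setU.
apply: sub_finite_set => v /=; apply: contraNP => /not_orP[].
move=> /negP/negPn/eqP s0 /negP/negPn/eqP t0.
by rewrite (_ : (_ + _) v = a * s v + t v) // s0 t0 mulr0 addr0.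
Qed.

HB.instance Definition _ :=
  GRing.isSubmodClosed.Build R (V -> R^o) finsupp_pred finsupp_submod.

Record free_normed := FreeNormed {
  coord :> V -> R^o ;
  coord_finsupp : coord \in finsupp_pred }.

HB.instance Definition _ := [isSub for coord].
HB.instance Definition _ := [Choice of free_normed by <:].
HB.instance Definition _ := [SubChoice_isSubLmodule of free_normed by <:].

Implicit Types (s t : free_normed) (v : V).

Lemma finite_coord t : finite_set [set v | t v != 0].
Proof. by have /asboolP := coord_finsupp t. Qed.

Definition l1norm t : R := \sum_(v \in [set: V]) `|t v|.

Lemma l1normE (A : set V) t : [set v | t v != 0] `<=` A ->
  l1norm t = \sum_(v \in A) `|t v|.
Proof.
move=> tA; rewrite /l1norm; apply/esym/fsbig_widen => //.
by move=> v /= [_ /(contra_not (@tA v))/negP/negPn/eqP->]; rewrite normr0.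
Qed.

Lemma l1norm_triangle s t : l1norm (s + t) <= l1norm s + l1norm t.
Proof.
set A := [set v | s v != 0] `|` [set v | t v != 0].
have finA : finite_set A by rewrite finite_setU; split; exact: finite_coord.
have stA : [set v | (s + t) v != 0] `<=` A.
  move=> v /=; apply: contraNP => /not_orP[].
  move=> /negP/negPn/eqP s0 /negP/negPn/eqP t0.
  by rewrite (_ : (_ + _) v = s v + t v) // s0 t0 addr0.
rewrite (l1normE stA) (@l1normE A s) ?(@l1normE A t) //.
- rewrite -fsbig_split //= !fsbig_finite //=.
  by apply: ler_sum => v _; exact: ler_normD.
- by move=> v; right.
- by move=> v; left.
Qed.

Lemma l1normZ (a : R) t : l1norm (a *: t) = `|a| * l1norm t.
Proof.
by rewrite /l1norm mulr_fsumr; apply: eq_fsbigr => v _; rewrite -normrM.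
Qed.

Lemma l1norm0_eq0 t : l1norm t = 0 -> t = 0.
Proof.
rewrite (l1normE (@subset_refl _ _)) => t0.
apply/val_inj/funext => v /=; apply/eqP/negPn/negP => tv0.
have := pfsumr_eq0 (finite_coord t) (fun i _ => normr_ge0 (t i)) t0 tv0.
by move/eqP; rewrite normr_eq0 (negbTE tv0).
Qed.

HB.instance Definition _ := Lmodule_isNormed.Build R free_normed
  l1norm_triangle l1normZ l1norm0_eq0.

Lemma delta_finsupp v : (fun w => (w == v)%:R : R^o) \in finsupp_pred.
Proof.
apply/asboolP; apply: (sub_finite_set _ (finite_set1 v)) => w /=.
by apply: contraNP => /eqP/negbTE->.
Qed.

Definition vertex v : free_normed := FreeNormed (delta_finsupp v).

Lemma vertex_independent (r : seq V) (a : V -> R) : uniq r ->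
  \sum_(v <- r) a v *: vertex v = 0 -> forall v, v \in r -> a v = 0.
Proof.
move=> ur a0 v vr.
have sumE : (\sum_(w <- r) a w *: vertex w) v = \sum_(w <- r) a w * (v == w)%:R.
  by apply: (big_morph (fun t : free_normed => t v)).
have: \sum_(w <- r) a w * (v == w)%:R = 0 by rewrite -sumE a0.
rewrite (bigD1_seq v) //= eqxx mulr1 big1 ?addr0 // => w wv.
by rewrite eq_sym (negbTE wv) mulr0.
Qed.

End FreeNormed.

Record simplicial_complex (V : choiceType) := SimplicialComplex {
  simplices : set {fset V} ;
  simplex_neq0 : forall s, simplices s -> s != fset0 ;
  simplex_sub : forall s t, simplices s -> t != fset0 ->
    (t `<=` s)%fset -> simplices t }.

Section Realisation.
Variables (R : realType) (V : choiceType).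

Definition simplex (s : {fset V}) : set (free_normed R V) :=
  convex_hull (@vertex R V @` [set` s]).

Definition open_simplex (s : {fset V}) : set (free_normed R V) :=
  relint (simplex s).

Variable Sigma : simplicial_complex V.

Definition polyhedron : set (free_normed R V) :=
  \bigcup_(s in simplices Sigma) simplex s.

(* A fresh name for the subtype [polyhedron], so that it carries the Whitehead
   topology and not the topology induced by the norm. *)
Definition realisation : Type := set_type polyhedron.

HB.instance Definition _ := Choice.on realisation.

Definition whitehead_open (U : set realisation) : Prop :=
  forall s, simplices Sigma s ->
    open ((set_val @` (U : set polyhedron)) `&` simplex s
          : set (subspace (simplex s))).

Lemma whitehead_openT : whitehead_open setT.
Proof.
move=> s Ss; apply/open_subspaceP; exists setT; first exact: openT.
apply/seteqP; split=> x [_ sx]; split=> //; split=> //.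
by have px : polyhedron x; [exists s | exists (SigSub (mem_set px))].
Qed.

Lemma whitehead_openI : setI_closed whitehead_open.
Proof.
move=> U W oU oW s Ss.
have := openI (oU _ Ss) (oW _ Ss); congr (open _).
rewrite setIACA setIid; congr (_ `&` _).
apply/seteqP; split=> [x [[p Up <-] [q Wq /val_inj qp]]|x [p [Up Wp] <-]].
  by exists p => //; split=> //; rewrite -qp.
by split; exists p.
Qed.

Lemma whitehead_open_bigU (I : Type) (f : I -> set realisation) :
  (forall i, whitehead_open (f i)) -> whitehead_open (\bigcup_i f i).
Proof.
move=> of_ s Ss; rewrite image_bigcup setI_bigcupl.
by apply: bigcup_open => i _; exact: of_.
Qed.

HB.instance Definition _ := isOpenTopological.Build realisation
  whitehead_openT whitehead_openI whitehead_open_bigU.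

Definition open_star (v : V) : set realisation :=
  [set p : polyhedron | exists s : {fset V},
    [/\ simplices Sigma s, v \in s & open_simplex s (set_val p)]].

End Realisation.

Section Canonical.
Variables (X : topologicalType) (n : nat) (UU : nat -> set (set X)).

(* The pair (U, k) is the index of U as a member of UU k. *)
Definition index_set : set (set X * nat) :=
  [set i | (i.2 <= n)%N /\ UU i.2 i.1].

Definition ker (s : {fset set X * nat}) : set X :=
  \bigcap_(i in [set` s]) i.1.

Definition nerve_simplices : set {fset set X * nat} :=
  [set s | [/\ s != fset0, [set` s] `<=` index_set & ker s !=set0]].

Definition Delta_simplices : set {fset set X * nat} :=
  [set s | nerve_simplices s /\ {in s &, injective snd}].

Lemma nerve_neq0 s : nerve_simplices s -> s != fset0.
Proof. by case. Qed.

Lemma nerve_sub s t : nerve_simplices s -> t != fset0 -> (t `<=` s)%fset ->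
  nerve_simplices t.
Proof.
move=> [_ sI [x sx]] t0 /fsubsetP ts; split=> //.
- by move=> i /ts; exact: sI.
- by exists x => i /ts; exact: sx.
Qed.

Definition nerve := SimplicialComplex nerve_neq0 nerve_sub.

Lemma Delta_neq0 s : Delta_simplices s -> s != fset0.
Proof. by case=> -[]. Qed.

Lemma Delta_sub s t : Delta_simplices s -> t != fset0 -> (t `<=` s)%fset ->
  Delta_simplices t.
Proof.
move=> [Ns inj] t0 ts; split; first exact: nerve_sub Ns t0 ts.
by move=> i j /(fsubsetP ts) si /(fsubsetP ts) sj; exact: inj.
Qed.

Definition Delta := SimplicialComplex Delta_neq0 Delta_sub.

Definition canonical_map (R : realType) (f : X -> realisation R Delta) : Prop :=
  continuous f /\
  forall i : set X * nat, simplices Delta [fset i]%fset ->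
    f @^-1` open_star i `<=` i.1.

End Canonical.

(* Main.v *)
(** From (a) to (b). For paracompact X, finite-cover dimension at most n passes
    to locally finite covers (Dowker), and a partition of unity then turns a
    cover of order at most n into n + 1 disjoint families of open sets, with
    functions xi_0, ..., xi_n summing to 1 and supported in their unions. Attach
    to each sequence of labels x_0, ..., x_j in X a singular simplex in Y,
    extending the ones attached to its proper faces by the asphericity of phi at
    the last label. The simplices whose faces of dimension k all lie in phi_k x
    do so near x as well, by lower local constancy; hence locally finite families
    of labels can be chosen one after the other, n + 1 times, so that all
    simplices with one label of each family active at x behave so. If the
    disjoint families refine these n + 1 layers, then evaluating, at the point
    (xi_0 x, ..., xi_n x), the simplex labelled by the members containing x is a
    continuous selection.

    From (b) to (c), take for phi_k x the subcomplex of Delta(U_0, ..., U_k) of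
    the simplices whose kernel contains x. From (c) to (a), pull back the open
    stars under a canonical map for the constant sequence of covers. *)

Require Import Defs.
From HB Require Import structures.
From mathcomp Require Import all_boot all_order all_algebra finmap.
From mathcomp Require Import all_classical all_reals all_analysis.
Import numFieldNormedType.Exports.
Local Open Scope classical_set_scope.
Local Open Scope ring_scope.

Set Implicit Arguments.
Unset Strict Implicit.
Unset Printing Implicit Defensive.
Import Order.TTheory GRing.Theory Num.Theory.
Local Open Scope card_scope.

(** * Paracompact spaces *)

(** Finitely many elements caught by a chain of sets are all caught by one of its members. This
    supplies the common stage when a chain of states is bounded in the Zorn argument below. *)
Lemma finite_chain_bound (S Q : Type) (A : set S) (P : S -> set Q)
    (F : set Q) :
  A !=set0 ->
  (forall a b, A a -> A b -> P a `<=` P b \/ P b `<=` P a) ->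
  finite_set F -> (forall q, F q -> exists2 a, A a & P a q) ->
  exists2 a, A a & F `<=` P a.
Proof.
move: P F; elim/Peq: Q => Q P F.
move=> [a0 Aa0] chain /finite_seqP[s ->].
elim: s => [|q s IH] FP; first by exists a0 => // q.
have [|a Aa sa] := IH.
  by move=> r rs; apply: FP => /=; rewrite inE rs orbT.
have [|b Ab Pbq] := FP q; first by rewrite /= mem_head.
have [ab|ba] := chain _ _ Aa Ab.
- exists b => // r /=; rewrite inE => /orP[/eqP->//|rs]; exact/ab/sa.
- exists a => // r /=; rewrite inE => /orP[/eqP->|]; [exact: ba|exact: sa].
Qed.

Lemma seq_arg_max d (O : orderType d) (T : eqType) (g : T -> O) (s : seq T) :
  s != [::] -> exists2 i, i \in s & forall j, j \in s -> (g j <= g i)%O.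
Proof.
elim: s => // a [|b s] IH _.
  by exists a; rewrite ?mem_head// => j; rewrite inE => /eqP->.
have [//|i iins imax] := IH; have [gai|gia] := leP (g a) (g i).
  exists i; first by rewrite inE iins orbT.
  by move=> j; rewrite inE => /orP[/eqP->|/imax].
exists a; first exact: mem_head.
move=> j; rewrite inE => /orP[/eqP->//|/imax ji].
exact: le_trans ji (ltW gia).
Qed.

Lemma filter_forall_finite (T I : Type) (F : set_system T) (A : set I)
    (P : I -> T -> Prop) : Filter F -> finite_set A ->
  (forall i, A i -> \forall x \near F, P i x) ->
  \forall x \near F, forall i, A i -> P i x.
Proof.
move=> FF; move: A P; elim/Peq: I => I A P /finite_seqP[s ->].
elim: s => [|i s IH] FP; first by apply: filterE => x i.
have Fi := FP i (mem_head _ _).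
have Fs := IH (fun j js => FP j (mem_behead (s := i :: s) js)).
by apply: filterS2 Fi Fs => x Pi Ps j /=; rewrite inE => /orP[/eqP->|/Ps].
Qed.

Section Paracompact.
Variable X : topologicalType.
Implicit Types (A B Q U V : set X) (CC DD UU VV : set (set X)).

Lemma locally_finite_open DD (x : X) : locally_finite DD ->
  exists N, [/\ open N, N x & finite_set [set V | DD V /\ V `&` N !=set0]].
Proof.
move=> /(_ x)[N Nx fN]; exists N°; split; first exact: open_interior.
  exact: Nx.
apply: sub_finite_set fN => V [DV [y [Vy Ny]]]; split=> //.
by exists y; split=> //; exact: interior_subset.
Qed.

(** A closure that contains a point of the open set [N] belongs to a member meeting [N]. So the
    union agrees on [N] with a finite union of closed sets. The predicate [P] selects a
    subfamily. *)
Lemma locally_finite_closed_bigcup DD (P : set (set X)) : locally_finite DD ->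
  closed (\bigcup_(V in DD `&` P) closure V).
Proof.
move=> lfD; rewrite -[X in closed X]setCK; apply: open_closedC.
rewrite openE => x nx; have [N [oN Nx fN]] := locally_finite_open x lfD.
set C := \bigcup_(V in [set V | DD V /\ V `&` N !=set0] `&` P) closure V.
have cC : closed C.
  apply: closed_bigcup => [|i _]; last exact: closed_closure.
  exact: finite_setIl.
have : nbhs x (N `&` ~` C).
  apply: open_nbhs_nbhs; split; first exact: openI oN (closed_openC cC).
  split=> // -[V [[DV _] PV] clV]; apply: nx; exists V => //.
apply: filterS => y [Ny nCy] [V [DV PV] clV]; apply: nCy; exists V => //.
by do !split=> //; exact/clV/open_nbhs_nbhs.
Qed.

Hypothesis pX : paracompact X.

(** Refine the cover by the given sets and the complement of [A], and unite the members meeting [A].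
    None of them lies in the complement of [A], so each has closure disjoint from [B]; local
    finiteness passes this to the union. Used with [A] or [B] a point or a closed set, it yields
    regularity, then normality. *)
Lemma paracompact_separation A B : closed A ->
  (forall x, A x -> exists Q, [/\ open Q, Q x & closure Q `&` B = set0]) ->
  exists Q, [/\ open Q, A `<=` Q & closure Q `&` B = set0].
Proof.
move=> cA sepA.
pose CC : set (set X) :=
  [set Q | open Q /\ closure Q `&` B = set0] `|` [set ~` A].
have cCC : open_cover CC.
  split; first by move=> U [[]//|->]; exact: closed_openC.
  apply/seteqP; split=> // x _; have [Ax|nAx] := pselect (A x).
    by have [Q [oO Ox OB]] := sepA _ Ax; exists Q => //; left.
  by exists (~` A) => //; right.
have [DD [[oD cD] rD lfD]] := pX cCC.
pose P : set (set X) := [set V | V `&` A !=set0].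
exists (\bigcup_(V in DD `&` P) V); split.
- by apply: bigcup_open => V [/oD].
- move=> x Ax; have : [set: X] x by [].
  by rewrite -cD => -[V DV Vx]; exists V => //; split=> //; exists x.
- have clo := locally_finite_closed_bigcup (P := P) lfD.
  apply/seteqP; split=> // x [clx Bx].
  have : (\bigcup_(V in DD `&` P) closure V) x.
    apply: clo; apply: closureS clx => y [V DV Vy]; exists V => //.
    exact: subset_closure.
  move=> [V [DV [a [Va Aa]]] clVx].
  have [U [[oU UB]|->] VU] := rD _ DV; last by case: (VU _ Va).
  by rewrite -UB; split=> //; apply: closureS clVx.
Qed.

Hypothesis hX : hausdorff_space X.

(** Separation is applied with the roles exchanged: the Hausdorff property separates each point of
    [B] from [x], so [B] has an open neighbourhood whose closure misses [x]. The complement of that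
    closure is the set sought. *)
Lemma paracompact_regular (x : X) B : closed B -> ~ B x ->
  exists Q, [/\ open Q, Q x & closure Q `&` B = set0].
Proof.
move=> cB nBx.
have [b Bb|Q [oO BO Ox]] := paracompact_separation (B := [set x]) cB.
  have bx : b != x by apply: contra_notN nBx => /eqP <-.
  move: hX; rewrite open_hausdorff.
  move=> /(_ _ _ bx)[[/= Q1 Q2] [/set_mem Q1b /set_mem Q2x]].
  move=> [oQ1 oQ2 /eqP Q12]; exists Q1; split=> //.
  apply/seteqP; split=> // y [clO /= yx]; subst y.
  have [z [Q1z Q2z]] := clO Q2 (open_nbhs_nbhs (conj oQ2 Q2x)).
  by have : (Q1 `&` Q2) z by []; rewrite Q12.
exists (~` closure Q); split; first exact/closed_openC/closed_closure.
  by move=> Ox'; have : (closure Q `&` [set x]) x by []; rewrite Ox.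
apply/seteqP; split=> // y [clO /BO Oy].
have [z [nOz Oz]] := clO Q (open_nbhs_nbhs (conj oO Oy)).
by apply: nOz; exact: subset_closure.
Qed.

Lemma paracompact_normal : normal_space X.
Proof.
move=> A cA B /set_nbhsP[C [oC AC CB]].
have [x Ax|Q [oO AO OC]] := paracompact_separation (B := ~` C) cA.
  by apply: paracompact_regular; [exact: open_closedC|move=> /(_ (AC _ Ax))].
exists Q; first by apply/set_nbhsP; exists Q; split.
move=> x Ox; apply: CB; apply: contrapT => nCx.
by have : (closure Q `&` ~` C) x by []; rewrite OC.
Qed.

(** Regularity allows a locally finite refinement whose members have closures inside some [U i];
    [D i] unites all the closures that fit into [U i]. One member may serve several indices, so no
    assignment is chosen. *)
Lemma closed_shrinking (I : Type) (A : set I) (U : I -> set X) :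
  (forall i, A i -> open (U i)) -> (forall x, exists2 i, A i & U i x) ->
  exists D : I -> set X, [/\ forall i, closed (D i), forall i, D i `<=` U i &
    forall x, exists2 i, A i & D i x].
Proof.
move=> oU cU.
pose CC : set (set X) := [set Q | open Q /\ exists2 i, A i & closure Q `<=` U i].
have cCC : open_cover CC.
  split; first by move=> Q [].
  apply/seteqP; split=> // x _; have [i Ai Uix] := cU x.
  have [|//|Q [oO Ox OU]] := @paracompact_regular x (~` U i).
  - exact: open_closedC (oU _ Ai).
  - exists Q => //; split=> //; exists i => //.
    by move/disjoints_subset: OU; rewrite setCK.
have [DD [[oD cD] rD lfD]] := pX cCC.
pose D i := \bigcup_(V in DD `&` [set V | closure V `<=` U i]) closure V.
exists D; split.
- by move=> i; exact: locally_finite_closed_bigcup.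
- by move=> i x [V [_ VU] /VU].
- move=> x; have : [set: X] x by []; rewrite -cD => -[V DV Vx].
  have [Q [_ [i Ai OU]] VO] := rD _ DV; exists i => //; exists V.
    by split=> //; exact: subset_trans (closureS VO) OU.
  exact: subset_closure.
Qed.

End Paracompact.

(** * Covering dimension and shrinkings of bounded order *)

Section FiniteDimension.
Variables (X : topologicalType) (n : nat).
Hypothesis dX : dim_le X n.

(* Refine the cover of X by the G i and the complement of F, and assign each
   refining set to one index. *)
Lemma closed_set_shrinking (I : choiceType) (A : set I) (F : set X)
    (G : I -> set X) :
  finite_set A -> closed F -> (forall i, A i -> open (G i)) ->
  (forall x, F x -> exists2 i, A i & G i x) ->
  exists H : I -> set X, [/\ forall i, open (H i),
    forall i, H i `<=` G i, forall i x, H i x -> A i,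
    forall x, F x -> exists2 i, A i & H i x &
    forall x, [set i | H i x] #<= `I_n.+1].
Proof.
move=> fA cF oG cG.
pose CC : set (set X) := G @` A `|` [set ~` F].
have cCC : open_cover CC.
  split; first by move=> _ [[i Ai <-]|->]; [exact: oG|exact: closed_openC].
  apply/seteqP; split=> // x _; have [Fx|nFx] := pselect (F x).
    by have [i Ai Gi] := cG _ Fx; exists (G i) => //; left; exists i.
  by exists (~` F) => //; right.
have fCC : finite_set CC.
  by rewrite finite_setU; split; [exact: finite_image|exact: finite_set1].
have [DD [[oD cD] _ rD ordD]] := dX cCC fCC.
have [[i0 Ai0]|noI] := pselect (exists i, A i); last first.
  exists (fun=> set0); split; [by move=> i; exact: open0|by move=> i x|by move=> i x| |].
    by move=> x Fx; have [i Ai _] := cG _ Fx; case: noI; exists i.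
  by move=> x; rewrite (_ : [set _ | _] = set0) ?card_ge0// -subset0.
pose ok D := exists2 i, A i & D `<=` G i.
have [alpha alphaP] : {alpha : set X -> I | forall D, ok D ->
    A (alpha D) /\ D `<=` G (alpha D)}.
  suff : forall D, {i | ok D -> A i /\ D `<=` G i}.
    by move=> f; exists (fun D => sval (f D)) => D; case: (f D).
  move=> D; have [/cid2[i Ai DG]|nD] := pselect (ok D); first by exists i.
  by exists i0.
pose H i := \bigcup_(D in [set D | [/\ DD D, ok D & alpha D = i]]) D.
exists H; split.
- by move=> i; apply: bigcup_open => D [/oD].
- by move=> i x [D [_ /alphaP[_ DG] <-] /DG].
- by move=> i x [D [_ /alphaP[Ai _] <-]].
- move=> x Fx; have : [set: X] x by []; rewrite -cD => -[D DD_D Dx].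
  have okD : ok D.
    have [U [[i Ai <-] DU|-> DF]] := rD _ DD_D; first by exists i.
    by case: (DF _ Dx).
  by exists (alpha D); [have [] := alphaP _ okD|exists D].
- move=> x; apply: card_le_trans (ordD x).
  apply: (card_le_trans _ (card_image_le alpha _)).
  apply: subset_card_le => i [D [DD_D okD <-] Dx].
  by exists D.
Qed.

End FiniteDimension.

Section Dowker.
Variables (X : topologicalType) (n : nat).
Hypotheses (pX : paracompact X) (dX : dim_le X n).

(* Dowker: the locally finite closed sets [closure V] meet only finitely many
   members of UU each, so the order of the cover can be cut down on them one at
   a time; by local finiteness the limit of a chain of such shrinkings is
   locally attained. *)
Lemma locally_finite_order_shrinking (UU : set (set X)) :
  open_cover UU -> locally_finite UU ->
  exists W : set X -> set X, [/\ forall U, UU U -> open (W U),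
    forall U, W U `<=` U, forall x, exists2 U, UU U & W U x &
    forall x, [set U | UU U /\ W U x] #<= `I_n.+1].
Proof.
move=> [oU cU] lfU.
have coverU x : exists2 U, UU U & U x.
  by have : [set: X] x by []; rewrite -cU => -[U ? ?]; exists U.
pose CC : set (set X) :=
  [set N | open N /\ finite_set [set U | UU U /\ U `&` N !=set0]].
have cCC : open_cover CC.
  split; first by move=> N [].
  apply/seteqP; split=> // x _; have [N [oN Nx fN]] := locally_finite_open x lfU.
  by exists N.
have [VV [[oV cV] rV lfV]] := pX cCC.
pose meetU V := [set U | UU U /\ U `&` V !=set0].
have fin_meetU V : VV V -> finite_set (meetU V).
  move=> /rV[N [_ fN] VN]; apply: sub_finite_set fN => U [UU_U [x [Ux Vx]]].
  by split=> //; exists x; split=> //; exact: VN.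
(* A state records the members of [VV] already treated and a shrunken cover whose order is at most
   [n] on the closures of these members. *)
pose state (p : set (set X) * (set X -> set X)) := [/\ p.1 `<=` VV,
  forall U, UU U -> open (p.2 U), forall U, p.2 U `<=` U,
  forall x, exists2 U, UU U & p.2 U x &
  forall V x, p.1 V -> closure V x -> [set U | UU U /\ p.2 U x] #<= `I_n.+1].
(* The last clause lets a later state lose points only inside closures of newly treated members.
   This is what makes chains locally stationary. *)
pose le_state (a b : {p | state p}) := [/\ (sval a).1 `<=` (sval b).1,
  forall U, (sval b).2 U `<=` (sval a).2 U &
  forall U x, (sval a).2 U x -> ~ (sval b).2 U x ->
    exists V, [/\ (sval b).1 V, ~ (sval a).1 V & closure V x]].
pose R a b := `[< le_state a b >].
have state0 : state (set0, id).
  by split=> [V []|U /oU|U|x|V x []] //=; exact: coverU.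

have Rxx t : R t t by apply/asboolP; split=> [V|U x|U x Ux /(_ Ux)].
have Rtrans r s t : R r s -> R s t -> R r t.
  move=> /asboolP[T1 W1 D1] /asboolP[T2 W2 D2]; apply/asboolP; split.
  - exact: subset_trans T1 T2.
  - by move=> U; exact: subset_trans (W2 U) (W1 U).
  - move=> U x rx ntx; have [sx|nsx] := pselect ((sval s).2 U x).
      have [V [tV nsV clV]] := D2 _ _ sx ntx.
      by exists V; split=> // /T1.
    by have [V [sV nrV clV]] := D1 _ _ rx nsx; exists V; split=> //; exact: T2.
have chain_bound (A : set {p | state p}) :
    total_on A R -> exists t, forall s, A s -> R s t.
  move=> totA; have [[a0 Aa0]|noA] := pselect (exists a, A a); last first.
    by exists (exist _ _ state0) => s As; case: noA; exists s.
  (* The bound of a chain: the union of the treated families and the intersection of the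
     shrinkings. *)
  pose T V := exists2 a, A a & (sval a).1 V.
  pose W U x := forall a, A a -> (sval a).2 U x.
  (* Only finitely many members of [VV] meet [N]. A stage [a] of the chain that has treated all of
     those ever treated loses no further point of [N], so there the limit equals that stage. *)
  have local x : exists N, [/\ open N, N x & exists2 a, A a &
      (forall U y, N y -> (sval a).2 U y -> W U y) /\
      (forall V y, N y -> T V -> closure V y -> (sval a).1 V)].
    have [N [oN Nx fN]] := locally_finite_open x lfV.
    have closN V y : N y -> closure V y -> V `&` N !=set0.
      by move=> Ny; apply; exact: open_nbhs_nbhs.
    have [||||b Ab Tb] := @finite_chain_bound _ _ A (fun a => (sval a).1)
      ([set V | VV V /\ V `&` N !=set0] `&` T).
    - by exists a0.
    - by move=> a b Aa Ab; have [] := totA _ _ Aa Ab => /asboolP[TT _ _];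
        [left|right].
    - exact: finite_setIl.
    - by move=> V [_ [a Aa Va]]; exists a.
    exists N; split=> //; exists b => //; split; last first.
      move=> V y Ny TV clV; apply: Tb; split=> //; split; last exact: closN Ny clV.
      by have [a Aa aV] := TV; have [sub _ _ _ _] := svalP a; exact: sub.
    move=> U y Ny bUy a Aa; have [] := totA _ _ Aa Ab.
      by move=> /asboolP[_ + _]; apply.
    move=> /asboolP[_ _ D]; apply: contrapT => naUy.
    have [V [aV nbV clV]] := D _ _ bUy naUy; apply: nbV; apply: Tb; split.
      split; last exact: closN Ny clV.
      by have [sub _ _ _ _] := svalP a; exact: sub.
    by exists a.
  have stTW : state (T, W).
    split => /=.
    - by move=> V [a Aa aV]; have [sub _ _ _ _] := svalP a; exact: sub.
    - move=> U UU_U; rewrite openE => x Wx.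
      have [N [oN Nx [a Aa [NW _]]]] := local x.
      have [_ oa _ _ _] := svalP a.
      have : nbhs x (N `&` (sval a).2 U).
        apply: open_nbhs_nbhs; split; first exact: openI oN (oa _ UU_U).
        by split=> //; exact: Wx.
      by apply: filterS => y [Ny aUy]; exact: NW.
    - by move=> U x /(_ _ Aa0); have [_ _ + _ _] := svalP a0; apply.
    - move=> x; have [N [oN Nx [a Aa [NW _]]]] := local x.
      have [_ _ _ ca _] := svalP a; have [U UU_U aUx] := ca x.
      by exists U => //; exact: NW.
    - move=> V x TV clV; have [N [oN Nx [a Aa [NW NT]]]] := local x.
      have [_ _ _ _ orda] := svalP a.
      apply: card_le_trans (orda _ _ (NT _ _ Nx TV clV) clV).
      by apply: subset_card_le => U [UU_U WUx]; split=> //; exact: WUx.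
  exists (exist _ _ stTW) => s As; apply/asboolP; split => /=.
  - by move=> V sV; exists s.
  - by move=> U x /(_ _ As).
  - move=> U x sUx nWx; have [N [oN Nx [a Aa [NW NT]]]] := local x.
    have naUx : ~ (sval a).2 U x by move/(NW _ _ Nx).
    have [] := totA _ _ As Aa => /asboolP[_ Wsa D]; last first.
      by case: naUx; exact: Wsa.
    by have [V [aV nsV clV]] := D _ _ sUx naUx; exists V; split=> //; exists a.
have [t tmax] := ZL_preorder (exist _ _ state0) Rxx Rtrans chain_bound.
have [Tsub oW WU cW ordW] := svalP t.
suff allT : VV `<=` (sval t).1.
  exists (sval t).2; split=> // x; have : [set: X] x by [].
  by rewrite -cV => -[V /allT tV Vx]; apply: ordW tV _; exact: subset_closure.
move=> V0 VV0; apply: contrapT => ntV0.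
set F := closure V0.
have [||H [oH HW HA cH ordH]] := @closed_set_shrinking _ _ dX (set X) (meetU V0)
  F (sval t).2 (fin_meetU _ VV0) (@closed_closure _ _).
- by move=> U [/oW].
- move=> x Fx; have [U UU_U Ux] := cW x; exists U => //; split=> //.
  have [y [Vy Uy]] := Fx _ (open_nbhs_nbhs (conj (oU _ UU_U) (WU _ _ Ux))).
  by exists y.
pose T' := (sval t).1 `|` [set V0].
(* The cover changes only on [F], where the shrinking [H] of order at most [n] replaces it. As [W']
   is contained in the old shrinking, the order on the closures treated before does not grow. *)
pose W' U := (sval t).2 U `\` F `|` H U.
have W'W U : W' U `<=` (sval t).2 U by move=> x [[]//|/HW].
have st' : state (T', W').
  split => /=.
  - by move=> V [/Tsub//|->].
  - move=> U /oW oWU; apply: openU => //; apply: openI => //.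
    exact/closed_openC/closed_closure.
  - by move=> U; exact: subset_trans (W'W U) (WU U).
  - move=> x; have [Fx|nFx] := pselect (F x).
      by have [U [UU_U _] HUx] := cH _ Fx; exists U => //; right.
    by have [U UU_U Ux] := cW x; exists U => //; left.
  - move=> V x [tV|->] clV.
      apply: card_le_trans (ordW _ _ tV clV).
      by apply: subset_card_le => U [UU_U /W'W].
    apply: card_le_trans (ordH x).
    by apply: subset_card_le => U [UU_U [[_ /(_ clV)]|]].
have Rt : R t (exist _ _ st').
  apply/asboolP; split=> //=; first by move=> V; left.
  move=> U x Wx nW'x; exists V0; split=> //; first by right.
  by apply: contrapT => nFx; apply: nW'x; left.
by have /asboolP[sub _ _] := tmax _ Rt; apply/ntV0/sub; right.
Qed.

End Dowker.

(** * Disjoint families and partitions of unity *)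

Section PartitionOfUnity.
Variables (R : realType) (X : topologicalType) (n : nat).
Hypotheses (hX : hausdorff_space X) (pX : paracompact X) (dX : dim_le X n).

Lemma paracompact_urysohn (D U : set X) : closed D -> open U -> D `<=` U ->
  exists g : X -> R, [/\ continuous g, forall x, 0 <= g x,
    forall x, D x -> g x = 1 & forall x, ~ U x -> g x = 0].
Proof.
move=> cD oU DU.
have sep : uniform_separator (~` U) D.
  apply: (iffLR (@normal_separatorP R X) (paracompact_normal pX hX)) => //.
    exact: open_closedC.
  by apply/disjoints_subset; exact: subsetC.
have [g [cg g01 gU gD]] := iffLR (@uniform_separatorP _ R _ _) sep.
exists g; split=> //.
- by move=> x; have /g01/= : range g (g x) by [exists x]; rewrite in_itv/= => /andP[].
- by move=> x Dx; apply: gD; exists x.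
- by move=> x Ux; apply: gU; exists x.
Qed.

Lemma lt_fun_near (f g : X -> R) (x : X) : continuous f -> continuous g ->
  f x < g x -> \forall y \near x, f y < g y.
Proof.
move=> cf cg fg; have : 0 < (g \- f) x by rewrite /= subr_gt0.
have : {for x, continuous (g \- f)} by exact: continuousB (cg x) (cf x).
move=> /cvgr_gt/[apply]; apply: filterS => y.
by rewrite /= subr_gt0.
Qed.

(* Members of one family are the sets where a k-element set of the functions
   zeta dominates all the others, whence the disjointness. *)
Lemma dim_disjoint_families (CC : set (set X)) : open_cover CC ->
  exists VV : nat -> set (set X), [/\
    forall k V, VV k V -> open V,
    forall k V, VV k V -> exists2 U, CC U & V `<=` U,
    forall k V V' x, VV k V -> VV k V' -> V x -> V' x -> V = V' &
    forall x, exists2 k, (k <= n)%N & exists2 V, VV k V & V x].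
Proof.
move=> /pX[UU [[oU cU] rU lfU]].
have [W [oW WU cW ordW]] :=
  locally_finite_order_shrinking pX dX (conj oU cU) lfU.
have [D [cD DW covD]] := closed_shrinking pX hX oW cW.
have [zeta zetaP] : {zeta : set X -> X -> R | forall U, UU U ->
    [/\ continuous (zeta U), forall x, 0 <= zeta U x,
    forall x, D U x -> zeta U x = 1 & forall x, ~ W U x -> zeta U x = 0]}.
  suff : forall U, {g : X -> R | UU U -> [/\ continuous g, forall x, 0 <= g x,
      forall x, D U x -> g x = 1 & forall x, ~ W U x -> g x = 0]}.
    by move=> f; exists (fun U => sval (f U)) => U; case: (f U).
  move=> U; have [UU_U|nU] := pselect (UU U); last by exists (fun=> 0).
  by have /cid[g gP] := paracompact_urysohn (cD U) (oW _ UU_U) (DW U); exists g.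
pose dom (s : {fset set X}) := [set x | (forall i, i \in s -> 0 < zeta i x) /\
  forall i j, i \in s -> UU j -> j \notin s -> zeta j x < zeta i x].
pose VV k : set (set X) := [set V | exists s : {fset set X},
  [/\ #|` s | = k.+1, [set` s] `<=` UU & V = dom s]].
exists VV; split.
- move=> k _ [s [_ sU ->]]; rewrite openE => x [spos sdom].
  have [N [oN Nx fN]] := locally_finite_open x lfU.
  have near_pos : \forall y \near x, forall i, i \in s -> 0 < zeta i y.
    apply: (@filter_forall_finite _ _ _ [set` s] (fun i y => 0 < zeta i y))
      => [|i is_].
      exact: finite_fset.
    have [ci _ _ _] := zetaP _ (sU _ is_).
    apply: (lt_fun_near (f := fun=> 0)) ci _ => [y|]; last exact: spos.
    exact: cvg_cst.
  (* Dominating all of [UU] is infinitely many conditions, but on [N] the functions of members not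
     meeting [N] vanish. Only finitely many strict inequalities have to persist near [x]. *)
  have near_dom : \forall y \near x, forall i, i \in s -> forall j,
      [set U | UU U /\ U `&` N !=set0] j -> j \notin s -> zeta j y < zeta i y.
    apply: (@filter_forall_finite _ _ _ [set` s] (fun i y => forall j,
      [set U | UU U /\ U `&` N !=set0] j -> j \notin s -> zeta j y < zeta i y))
      => [|i is_].
      exact: finite_fset.
    apply: (@filter_forall_finite _ _ _ _
      (fun j y => j \notin s -> zeta j y < zeta i y)) => // j [Uj _].
    have [ci _ _ _] := zetaP _ (sU _ is_); have [cj _ _ _] := zetaP _ Uj.
    have [js|njs] := boolP (j \in s); first by apply: filterE.
    by apply: filterS (lt_fun_near cj ci (sdom _ _ is_ Uj njs)) => y.
  apply: filterS3 near_pos near_dom (open_nbhs_nbhs (conj oN Nx)) => y ypos ydom Ny.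
  split=> // i j is_ Uj njs.
  have [mj|nmj] := pselect (j `&` N !=set0); first exact: ydom is_ _ _ njs.
  have [_ _ _ -> ] := zetaP _ Uj; first exact: ypos.
  by move=> /WU jy; apply: nmj; exists y.
- move=> k _ [s [sk sU ->]].
  have /fset0Pn[i is_] : s != fset0 by rewrite -cardfs_gt0 sk.
  have [U CU iU] := rU _ (sU _ is_); exists U => // x [spos _]; apply: iU; apply: WU.
  apply: contrapT => nW; have [_ _ _ z0] := zetaP _ (sU _ is_).
  by have := spos _ is_; rewrite z0 ?ltxx.
- move=> k _ _ x [s [sk sU ->]] [t [tk tU ->]] [spos sdom] [tpos tdom].
  congr dom; apply/eqP; have [st|/fsubsetPn[i is_ nit]] := boolP (s `<=` t)%fset.
    by rewrite eqEfcard st sk tk leqnn.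
  have [ts|/fsubsetPn[j jt njs]] := boolP (t `<=` s)%fset.
    by rewrite eq_sym eqEfcard ts sk tk leqnn.
  have ij := sdom _ _ is_ (tU _ jt) njs.
  by have := tdom _ _ jt (sU _ is_) nit; rewrite ltNge (ltW ij).
- move=> x; pose P := [set U | UU U /\ 0 < zeta U x].
  have PW : P `<=` [set U | UU U /\ W U x].
    move=> U [UU_U zU]; split=> //; apply: contrapT => nW.
    by have [_ _ _ z0] := zetaP _ UU_U; move: zU; rewrite z0 ?ltxx.
  have cardP : P #<= `I_n.+1 := card_le_trans (subset_card_le PW) (ordW x).
  have fP : finite_set P by apply/finite_set_leP; exists n.+1.
  have [U0 UU0 DU0] := covD x.
  have PU0 : P U0 by split=> //; have [_ _ -> //] := zetaP _ UU0.
  have [|i iP imax] := @seq_arg_max _ _ _ (fun U => zeta U x) (fset_set P).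
    have U0P : U0 \in fset_set P by rewrite in_fset_set// inE.
    by apply/eqP => P0; have : U0 \in enum_fset (fset_set P) by []; rewrite P0.
  pose s : {fset set X} := [fset j in fset_set P | zeta j x == zeta i x]%fset.
  have is_ : i \in s by rewrite !inE /= iP eqxx.
  have [UU_i zi] : P i by move: iP; rewrite in_fset_set// inE.
  have s_gt0 : (0 < #|` s|)%N by rewrite cardfs_gt0; apply/fset0Pn; exists i.
  have sP j : j \in s -> P j /\ zeta j x = zeta i x.
    by rewrite !inE /= => /andP[+ /eqP]; rewrite in_fset_set// inE.
  exists #|` s|.-1.
    have : (#|` s| <= n.+1)%N.
      apply: (leq_trans (fsubset_leq_card (fset_sub _ _))).
      by rewrite geq_card_fset_set.
    by case: #|` s| s_gt0.
  exists (dom s); first by exists s; split; [rewrite prednK|move=> j /sP[[]]|].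
  split=> [j /sP[[]]//|j l /sP[_ ->] UU_l nls].
  have [Pl|nPl] := pselect (P l).
    have lP : l \in fset_set P by rewrite in_fset_set// inE.
    rewrite lt_neqAle imax// andbT; apply: contra nls => zl.
    by rewrite !inE /= lP zl.
  have [_ z_ge0 _ _] := zetaP _ UU_l.
  by apply: le_lt_trans zi; rewrite leNgt; apply/negP => zl; apply: nPl.
Qed.

Lemma dim_partition_of_unity (CC : set (set X)) : open_cover CC ->
  exists (VV : 'I_n.+1 -> set (set X)) (xi : 'I_n.+1 -> X -> R), [/\
    forall k V, VV k V -> open V /\ exists2 U, CC U & V `<=` U,
    forall k V V' x, VV k V -> VV k V' -> V x -> V' x -> V = V',
    forall k, continuous (xi k) /\ forall x, 0 <= xi k x,
    forall x, \sum_k xi k x = 1 &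
    forall k x, (exists2 V, VV k V & V x) \/ \forall y \near x, xi k y = 0].
Proof.
move=> /dim_disjoint_families[VV [oV VC dV covV]].
pose G (k : 'I_n.+1) := \bigcup_(V in VV k) V.
have oG k : open (G k) by apply: bigcup_open => V /oV.
have [D [cD DG covD]] := closed_shrinking pX hX (A := setT) (fun k _ => oG k)
  (fun x => let: ex_intro2 k kn Vx := covV x in
            ex_intro2 _ _ (Ordinal (kn : (k < n.+1)%N)) I Vx).
have [g gP] : {g : 'I_n.+1 -> X -> R | forall k, [/\ continuous (g k),
    forall x, 0 <= g k x,
    forall x, D k x -> g k x = 1 & forall x, ~ G k x -> g k x = 0]}.
  suff : forall k, {g : X -> R | [/\ continuous g, forall x, 0 <= g x,
    forall x, D k x -> g x = 1 & forall x, ~ G k x -> g x = 0]}.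
    by move=> f; exists (fun k => sval (f k)) => k; case: (f k).
  by move=> k; apply: cid; exact: paracompact_urysohn.
(* Cutting off at one half makes [eta k] vanish on a whole neighbourhood of every point outside
   [G k], where [g k] is 0, while it stays positive on [D k], where [g k] is 1. *)
pose eta k x : R := Num.max 0 (g k x - 2^-1).
have ceta k : continuous (eta k).
  have [cg _ _ _] := gP k => x.
  apply: (@continuous_max _ _ (fun=> 0) (fun x => g k x - 2^-1)).
    exact: cvg_cst.
  by apply: continuousB; [exact: cg|exact: cvg_cst].
have eta_ge0 k x : 0 <= eta k x by rewrite /eta le_max lexx.
pose S x := \sum_k eta k x.
have S_gt0 x : 0 < S x.
  have [k _ Dx] := covD x; have [_ _ g1 _] := gP k.
  apply: (@lt_le_trans _ _ (eta k x)).
    by rewrite /eta g1// lt_max subr_gt0 invf_lt1 ?ltr1n ?orbT.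
  by rewrite /S (bigD1 k)//= lerDl; apply: sumr_ge0.
have cS : continuous S.
  by apply: continuous_big => [|k _]; [exact: add_continuous|exact: ceta].
exists (fun k => VV k), (fun k x => eta k x / S x); split.
- by move=> k V VkV; split; [exact: oV VkV|exact: VC VkV].
- by move=> k; exact: dV.
- move=> k; split=> [x|x]; last by rewrite divr_ge0// ltW.
  apply: cvgM; first exact: ceta.
  by apply: cvgV; [rewrite gt_eqF|exact: cS].
- by move=> x; rewrite -mulr_suml mulfV// gt_eqF//; exact: S_gt0.
- move=> k x; have [Gx|nGx] := pselect (G k x); [left|right].
    by have [V] := Gx; exists V.
  have [cg _ _ g0] := gP k.
  have : \forall y \near x, g k y < 2^-1.
    apply: (lt_fun_near (g := fun=> 2^-1)) => //; first by move=> y; exact: cvg_cst.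
    by rewrite g0.
  apply: filterS => y gy; rewrite /eta max_l ?mul0r// subr_le0; exact: ltW.
Qed.

End PartitionOfUnity.

(** * Filling spheres in simplices *)

Section SubspaceContinuity.

Lemma within_continuous_compS (T U V : topologicalType) (A : set T)
    (B : set U) (f : T -> U) (g : U -> V) :
  {within A, continuous f} -> f @` A `<=` B -> {within B, continuous g} ->
  {within A, continuous (g \o f)}.
Proof.
move=> /subspace_continuousP cf fAB /subspace_continuousP cg.
apply/subspace_continuousP => x Ax W Wgf.
have Bfx : B (f x) by apply: fAB; exists x.
have : nbhs x [set y | A y -> B (f y) -> W (g (f y))].
  exact: cf _ Ax _ (cg _ Bfx _ Wgf).
by apply: filterS => y Wy Ay; apply: Wy => //; apply: fAB; exists y.
Qed.

Lemma within_continuous_for (T U : topologicalType) (A : set T) (f : T -> U) :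
  (forall x, A x -> {for x, continuous f}) -> {within A, continuous f}.
Proof. by move=> cf; apply: continuous_in_subspaceT => x /set_mem /cf. Qed.

Lemma within_continuous_eq (T U : topologicalType) (A : set T) (f g : T -> U) :
  (forall x, A x -> f x = g x) -> {within A, continuous f} ->
  {within A, continuous g}.
Proof.
by move=> fg; apply: subspace_eq_continuous => x /set_mem; exact: fg.
Qed.

Lemma within_continuous_bigcup (T U : topologicalType) (I : choiceType) (s : seq I)
    (A : I -> set T) (f : T -> U) :
  (forall i, i \in s -> closed (A i)) ->
  (forall i, i \in s -> {within A i, continuous f}) ->
  {within \bigcup_(i in [set` s]) A i, continuous f}.
Proof.
elim: s => [|i s IH] cA cf.
  rewrite (_ : [set` [::]] = set0) ?bigcup_set0; first exact: continuous_subspace0.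
  by apply/seteqP; split.
rewrite (_ : [set` i :: s] = i |` [set` s]); last first.
  by apply/seteqP; split => j /=; rewrite inE => /predU1P.
rewrite bigcup_setU1; apply: withinU_continuous.
- by apply: cA; exact: mem_head.
- rewrite bigcup_seq; apply: closed_bigsetU => j js.
  by apply: cA; rewrite inE js orbT.
- by apply: cf; exact: mem_head.
- by apply: IH => j js; [apply: cA|apply: cf]; rewrite inE js orbT.
Qed.

Lemma cvg_rV (R : realType) (T : Type) (F : set_system T) (m : nat)
    (f : T -> 'rV[R]_m) (l : 'rV[R]_m) : Filter F ->
  (forall i, f x 0 i @[x --> F] --> l 0 i) -> f @ F --> l.
Proof.
move=> FF fl W [P lP PW]; apply: (@filterS _ F _ _ _ (fun x => PW (f x))) => /=.
have : \forall x \near F, forall i, setT i -> P 0 i (f x 0 i).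
  apply: (@filter_forall_finite _ _ _ _ (fun i x => P 0 i (f x 0 i))) => [|i _].
    exact: finite_finset.
  exact: fl (lP 0 i).
by apply: filterS => x Px i j; rewrite ord1; exact: Px.
Qed.

End SubspaceContinuity.

Section EuclideanNorm.
Variables (R : realType) (m : nat).
Implicit Types w : 'rV[R]_m.

(** The norm carried by row vectors is the maximum norm, whereas [sphere] and [cball] are
    Euclidean. *)
Definition enorm w : R := Num.sqrt (\sum_i w 0 i ^+ 2).

Lemma enorm_ge0 w : 0 <= enorm w. Proof. exact: sqrtr_ge0. Qed.

Lemma enorm_sq w : enorm w ^+ 2 = \sum_i w 0 i ^+ 2.
Proof. by rewrite sqr_sqrtr// sumr_ge0// => i _; exact: sqr_ge0. Qed.

Lemma enorm_eq0 w : enorm w = 0 -> w = 0.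
Proof.
move=> w0; have := enorm_sq w; rewrite w0 expr0n => /esym/eqP.
rewrite psumr_eq0 => [/allP s0|k _]; last exact: sqr_ge0.
apply/rowP => i; rewrite mxE; apply/eqP.
by have := s0 i (mem_index_enum _); rewrite sqrf_eq0.
Qed.

Lemma enormZ (a : R) w : 0 <= a -> enorm (a *: w) = a * enorm w.
Proof.
move=> a0; rewrite /enorm (_ : \sum_i _ = a ^+ 2 * \sum_i w 0 i ^+ 2).
  by rewrite sqrtrM ?sqr_ge0// sqrtr_sqr ger0_norm.
by rewrite mulr_sumr; apply: eq_bigr => i _; rewrite mxE exprMn.
Qed.

Lemma enorm0 : enorm 0 = 0.
Proof. by rewrite -(scale0r 0) enormZ// mul0r. Qed.

Lemma enorm_continuous : continuous enorm.
Proof.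
suff : continuous (@Num.sqrt R \o (fun w : 'rV[R]_m => \sum_i w 0 i ^+ 2)) by [].
move=> w; apply: continuous_comp; last exact: sqrt_continuous.
apply: continuous_big => [|i _ u]; first exact: add_continuous.
by apply: (@continuousM _ _ (fun u : 'rV[R]_m => u 0 i) (fun u => u 0 i));
  exact: coord_continuous.
Qed.

End EuclideanNorm.

Lemma sphere_delta (R : realType) (m : nat) :
  sphere (delta_mx 0 ord0 : 'rV[R]_m.+1).
Proof.
rewrite /sphere/= (bigD1 ord0)//= big1 => [|i i0].
  by rewrite mxE !eqxx expr1n addr0.
by rewrite mxE (negbTE i0) andbF expr0n.
Qed.

(** * Faces of the standard simplex compared with Euclidean balls *)

Section BallComparison.
Variables (R : realType) (N : nat).
Implicit Types (A B : {set 'I_N}) (t : 'rV[R]_N).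

Definition face A : set 'rV[R]_N := [set t | [/\ forall i, 0 <= t 0 i,
  \sum_i t 0 i = 1 & forall i, i \notin A -> t 0 i = 0]].

Definition face_boundary A : set 'rV[R]_N :=
  [set t | face A t /\ exists2 i, i \in A & t 0 i = 0].

Lemma face_compact A : compact (face A).
Proof.
apply: bounded_closed_compact.
  exists 1; split=> // M M1 t [t0 t1 _]; rewrite /= [leLHS]mx_normrE.
  apply: bigmax_le => [|[i j] _] /=; first by rewrite ltW// (lt_trans ltr01).
  rewrite ord1 ger0_norm//; apply: le_trans (ltW M1).
  by rewrite -t1 (bigD1 j)//= lerDl sumr_ge0.
have -> : face A = (\bigcap_i [set t | 0 <= t 0 i]) `&`
    [set t | \sum_i t 0 i = 1] `&` (\bigcap_(i in [set` ~: A]) [set t | t 0 i = 0]).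
  apply/seteqP; split=> [t [t0 t1 tA]|t [[t0 t1] tA]].
    by split; [split=> // i _; exact: t0|move=> i; rewrite /= inE; exact: tA].
  by split=> // i; [exact: t0|move=> iA; apply: tA; rewrite /= inE].
apply: closedI; first apply: closedI.
- apply: closed_bigI => i _.
  suff : closed ((fun t : 'rV[R]_N => t 0 i) @^-1` [set x | 0 <= x]) by [].
  by apply: preimage_closed => [t _|]; [exact: coord_continuous|exact: closed_ge].
- suff : closed ((fun t : 'rV[R]_N => \sum_i t 0 i) @^-1` [set 1]) by [].
  apply: preimage_closed => [t _|]; last exact: closed_eq.
  apply: continuous_big => [|i _]; first exact: add_continuous.
  exact: coord_continuous.
- apply: closed_bigI => i _.
  suff : closed ((fun t : 'rV[R]_N => t 0 i) @^-1` [set 0]) by [].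
  by apply: preimage_closed => [t _|]; [exact: coord_continuous|exact: closed_eq].
Qed.

Lemma face_closed A : closed (face A).
Proof.
apply: compact_closed; [exact: norm_hausdorff|exact: face_compact].
Qed.

Section Enumeration.
Variables (j : nat) (A : {set 'I_N}) (e : 'I_j.+2 -> 'I_N).
Hypotheses (e_inj : injective e) (eA : forall i, (i \in A) = (i \in codom e)).

(** The differences in [tail] vanish only where all coordinates on the face are equal, and there the
    product of the coordinates is positive; so [den] is positive on the face. The product vanishes
    on the boundary, hence [to_ball] maps the face into the ball and its boundary into the
    sphere. *)
Let tail t : 'rV[R]_j.+1 := \row_i (t 0 (e (lift ord0 i)) - t 0 (e ord0)).
Let den t : R := enorm (tail t) + \prod_i t 0 (e i).
Let to_ball t : 'rV[R]_j.+1 := (den t)^-1 *: tail t.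

(** Left inverse of [to_ball] on the boundary. [ext] restores the coordinate 0 of the base vertex,
    subtracting the minimum makes all coordinates nonnegative with one of them zero, and dividing by
    [tot] makes the sum 1. The default 0 in [low] is the value of [ext] at the base vertex, so [low]
    is the minimum of all [j.+2] coordinates. *)
Let ext (w : 'rV[R]_j.+1) (i : 'I_j.+2) : R :=
  if unlift ord0 i is Some k then w 0 k else 0.
Let low (w : 'rV[R]_j.+1) : R := \big[Num.min/0]_i w 0 i.
Let tot (w : 'rV[R]_j.+1) : R := \sum_i (ext w i - low w).
Let of_sphere (w : 'rV[R]_j.+1) : 'rV[R]_N :=
  \row_l \sum_i (ext w i - low w) / tot w * (e i == l)%:R.

Let sum_face t : face A t -> \sum_i t 0 (e i) = 1.
Proof.
move=> [_ <- tA]; rewrite [RHS](bigID (fun i => i \in A))/=.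
rewrite [X in _ + X]big1 => [|i /tA//].
rewrite addr0 (eq_bigl (fun i => i \in codom e)) => [|i]; last by rewrite eA.
by rewrite -big_uniq ?big_image//; exact/injectiveP.
Qed.

Let tail_eq0 t : enorm (tail t) = 0 -> forall i, t 0 (e i) = t 0 (e ord0).
Proof.
move=> /enorm_eq0 t0 i; case: (unliftP ord0 i) => [k ->|->//].
by apply/eqP; rewrite -subr_eq0; move/rowP: t0 => /(_ k); rewrite !mxE => ->.
Qed.

Let den_gt0 t : face A t -> 0 < den t.
Proof.
move=> ft; have [t0 _ _] := ft.
have p0 : 0 <= \prod_i t 0 (e i) by apply: prodr_ge0.
have [n0|n0] := eqVneq (enorm (tail t)) 0; last first.
  by rewrite ltr_pwDl// lt_def n0 enorm_ge0.
rewrite /den n0 add0r; apply: prodr_gt0 => i _; rewrite (tail_eq0 n0).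
rewrite lt_def t0 andbT; apply/eqP => e0; have /eqP := sum_face ft.
by rewrite big1 => [|k _]; rewrite ?(tail_eq0 n0)// eq_sym oner_eq0.
Qed.

Let to_ball_sq t : \sum_i to_ball t 0 i ^+ 2 = (enorm (tail t) / den t) ^+ 2.
Proof.
rewrite exprMn enorm_sq mulr_suml; apply: eq_bigr => i _.
by rewrite mxE exprMn mulrC.
Qed.

Let to_ball_ball t : face A t -> cball (to_ball t).
Proof.
move=> ft; have [t0 _ _] := ft; have d0 := den_gt0 ft.
rewrite /cball/= to_ball_sq; apply: exprn_ile1.
  by rewrite divr_ge0 ?enorm_ge0// ltW.
by rewrite ler_pdivrMr// mul1r lerDl prodr_ge0.
Qed.

Let den_boundary t : face_boundary A t -> den t = enorm (tail t).
Proof.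
move=> [ft [i]]; rewrite eA => /codomP[k ->] tk.
by rewrite /den (bigD1 k)//= tk mul0r addr0.
Qed.

Let to_ball_sphere t : face_boundary A t -> sphere (to_ball t).
Proof.
move=> bt; have d0 := den_gt0 bt.1.
rewrite /sphere/= to_ball_sq -(den_boundary bt) mulfV ?expr1n//.
by rewrite gt_eqF.
Qed.

Let low_le w i : low w <= ext w i.
Proof.
rewrite /ext; case: unliftP => [k _|_]; [exact: bigmin_le|exact: bigmin_le_id].
Qed.

Let low_eq w : exists i, ext w i = low w.
Proof.
have /bigmin_leP[l0|[k _ kl]] : low w <= low w by [].
  exists ord0; apply/eqP; rewrite eq_le low_le andbT.
  by rewrite /ext unlift_none.
exists (lift ord0 k); apply/eqP; rewrite eq_le low_le andbT.
by rewrite /ext liftK.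
Qed.

Let tot_gt0 w : w != 0 -> 0 < tot w.
Proof.
move=> w0; rewrite lt_def sumr_ge0 ?andbT => [|i _]; last by rewrite subr_ge0.
apply: contra w0; rewrite psumr_eq0 => [/allP s0|i _]; last by rewrite subr_ge0.
have s i : ext w i = low w.
  by apply/eqP; rewrite -subr_eq0; exact: s0 (mem_index_enum _).
apply/eqP/rowP => k; rewrite mxE.
have := s (lift ord0 k); rewrite -(s ord0) /ext liftK => ->.
by rewrite unlift_none.
Qed.

Let of_sphereE w i : of_sphere w 0 (e i) = (ext w i - low w) / tot w.
Proof.
rewrite mxE (bigD1 i)//= eqxx mulr1 big1 ?addr0// => k ki.
by rewrite (inj_eq e_inj) (negbTE ki) mulr0.
Qed.

Let of_sphere_out w l : l \notin A -> of_sphere w 0 l = 0.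
Proof.
rewrite eA => lA; rewrite mxE big1// => i _; case: eqP => [il|_]; last exact: mulr0.
by case/negP: lA; rewrite -il; exact: codom_f.
Qed.

Let sphere_neq0 (w : 'rV[R]_j.+1) : sphere w -> w != 0.
Proof.
rewrite /sphere/= => w1; apply/eqP => w0; move: w1; rewrite w0 big1 => [/eqP|i _].
  by rewrite eq_sym oner_eq0.
by rewrite mxE expr0n.
Qed.

Let of_sphere_boundary w : sphere w -> face_boundary A (of_sphere w).
Proof.
move=> /sphere_neq0 /tot_gt0 T0; split.
  split=> [l||l]; last exact: of_sphere_out.
    have [|/of_sphere_out->//] := boolP (l \in A).
    by rewrite eA => /codomP[i ->]; rewrite of_sphereE divr_ge0 ?subr_ge0// ltW.
  rewrite (bigID (fun i => i \in A))/= [X in _ + X]big1 => [|i /of_sphere_out//].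
  rewrite addr0 (eq_bigl (fun i => i \in codom e)) => [|i]; last by rewrite eA.
  rewrite -big_uniq ?big_image/=; last exact/injectiveP.
  under eq_bigr do rewrite of_sphereE.
  by rewrite -mulr_suml mulfV// gt_eqF.
have [i il] := low_eq w; exists (e i); first by rewrite eA codom_f.
by rewrite of_sphereE il subrr mul0r.
Qed.

(** Differences determine the coordinates up to a common shift, which is fixed on the boundary
    because the minimum is 0 there. The common factor [(den t)^-1] cancels against the total. *)
Let to_ballK t : face_boundary A t -> of_sphere (to_ball t) = t.
Proof.
move=> bt; have [ft [i0]] := bt; rewrite eA => /codomP[k0 ->] tk0.
have [t0 _ tA] := ft; have d0 := den_gt0 ft.
have extE i : ext (to_ball t) i = (t 0 (e i) - t 0 (e ord0)) / den t.
  rewrite /ext; case: unliftP => [k ->|->]; last by rewrite subrr mul0r.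
  by rewrite !mxE mulrC.
have lowE : low (to_ball t) = - t 0 (e ord0) / den t.
  apply/eqP; rewrite eq_le; apply/andP; split.
    by rewrite (le_trans (low_le _ k0))// extE tk0 sub0r.
  have [i <-] := low_eq (to_ball t).
  by rewrite extE ler_pM2r ?invr_gt0// lerDr.
have diffE i : ext (to_ball t) i - low (to_ball t) = t 0 (e i) / den t.
  by rewrite extE lowE -mulrBl opprK subrK.
have totE : tot (to_ball t) = (den t)^-1.
  rewrite /tot; under eq_bigr do rewrite diffE.
  by rewrite -mulr_suml sum_face// mul1r.
apply/rowP => l; have [|lA] := boolP (l \in A); last first.
  by rewrite of_sphere_out// tA.
rewrite eA => /codomP[i ->]; rewrite of_sphereE diffE totE invrK.
by rewrite mulfVK// gt_eqF.
Qed.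

Let to_ball_continuous : {within face A, continuous to_ball}.
Proof.
apply: within_continuous_for => t ft; apply: (@cvg_rV _ _ (nbhs t)) => i.
have ctail k : continuous (fun t => tail t 0 k).
  rewrite (_ : (fun t => _) = fun t => t 0 (e (lift ord0 k)) - t 0 (e ord0)).
    move=> u; apply: (@continuousB _ _ _ (fun t => t 0 (e (lift ord0 k)))
      (fun t => t 0 (e ord0))); exact: coord_continuous.
  by apply/funext => u; rewrite mxE.
have cden : continuous den.
  have ctl : continuous tail.
    by move=> u; apply: (@cvg_rV _ _ (nbhs u)) => k; exact: ctail.
  have cnrm : continuous (@enorm R j.+1 \o tail).
    by move=> u; apply: continuous_comp; [exact: ctl|exact: enorm_continuous].
  move=> u; apply: (@continuousD _ _ _ (@enorm R j.+1 \o tail)); first exact: cnrm.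
  apply: continuous_big => [|k _]; first exact: mul_continuous.
  exact: coord_continuous.
rewrite mxE (_ : (fun t => _) = fun t => (den t)^-1 * tail t 0 i); last first.
  by apply/funext => u; rewrite mxE.
apply: cvgM; last exact: ctail.
by apply: cvgV; [rewrite gt_eqF// den_gt0|exact: cden].
Qed.

Let of_sphere_continuous : {within @sphere R j, continuous of_sphere}.
Proof.
apply: within_continuous_for => w /sphere_neq0 /tot_gt0 T0.
apply: (@cvg_rV _ _ (nbhs w)) => l.
have cext i : continuous (fun w => ext w i).
  rewrite /ext; case: unliftP => [k _|_]; first exact: coord_continuous.
  exact: cst_continuous.
have clow : continuous low.
  apply: continuous_big => [|k _]; first exact: min_continuous.
  exact: coord_continuous.
have cd i : continuous (fun w => ext w i - low w).
  by move=> u; apply: (@continuousB _ _ _ (fun w => ext w i) low);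
    [exact: cext|exact: clow].
rewrite mxE (_ : (fun w => _) = fun w =>
  \sum_i (ext w i - low w) / tot w * (e i == l)%:R); last first.
  by apply/funext => u; rewrite mxE.
have ctot : continuous tot.
  by apply: continuous_big => [|k _]; [exact: add_continuous|exact: cd].
apply: cvg_big => [|i _]; first exact: add_continuous.
apply: (@cvgM _ _ (nbhs w) _ (fun w => (ext w i - low w) / tot w)).
  apply: (@cvgM _ _ (nbhs w) _ (fun w => ext w i - low w)); first exact: cd.
  by apply: cvgV; [rewrite gt_eqF|exact: ctot].
exact: cvg_cst.
Qed.

(** Carry [s] to the sphere by [of_sphere], extend over the ball, and return by [to_ball]. It is
    enough that [of_sphere] undoes [to_ball] on the boundary; no homeomorphism between face and ball
    is built. *)
Lemma face_extension_enum (Y : topologicalType) (S B : set Y)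
    (s : 'rV[R]_N -> Y) :
  sphere_extends R j S B -> {within face_boundary A, continuous s} ->
  s @` face_boundary A `<=` S ->
  exists g : 'rV[R]_N -> Y, [/\ {within face A, continuous g},
    g @` face A `<=` B & forall t, face_boundary A t -> g t = s t].
Proof.
move=> ext_SB cs sS.
have [||g [cg gB gs]] := ext_SB (s \o of_sphere).
- apply: within_continuous_compS of_sphere_continuous _ cs.
  by move=> _ [w Sw <-]; exact: of_sphere_boundary.
- move=> _ [w Sw <-]; apply: sS; exists (of_sphere w) => //.
  exact: of_sphere_boundary.
exists (g \o to_ball); split.
- apply: within_continuous_compS to_ball_continuous _ cg.
  by move=> _ [t ft <-]; exact: to_ball_ball.
- move=> _ [t ft <-]; apply: gB; exists (to_ball t) => //.
  exact: to_ball_ball.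
- by move=> t bt; rewrite /= gs /= ?to_ballK//; exact: to_ball_sphere.
Qed.

End Enumeration.

Lemma face_extension (j : nat) (A : {set 'I_N}) (Y : topologicalType)
    (S B : set Y) (s : 'rV[R]_N -> Y) : #|A| = j.+2 ->
  sphere_extends R j S B -> {within face_boundary A, continuous s} ->
  s @` face_boundary A `<=` S ->
  exists g : 'rV[R]_N -> Y, [/\ {within face A, continuous g},
    g @` face A `<=` B & forall t, face_boundary A t -> g t = s t].
Proof.
move=> cardA; apply: (@face_extension_enum j A
  (fun i => enum_val (cast_ord (esym cardA) i))).
  by apply: inj_comp enum_val_inj _; exact: cast_ord_inj.
move=> i; apply/idP/codomP => [iA|[k ->]]; last exact: enum_valP.
exists (cast_ord cardA (enum_rank_in iA i)); rewrite cast_ordK.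
by rewrite enum_rankK_in.
Qed.

End BallComparison.

(** * Simplices labelled by points of the base *)

Lemma card_set_ord (m : nat) (A : {set 'I_m}) : (#|A| <= m)%N.
Proof. by have := max_card (mem A); rewrite card_ord. Qed.

Section SkeletalMaps.
Variables (R : realType) (n : nat) (X Y : topologicalType) (y0 : Y)
  (phi : nat -> X -> set Y).
Notation labelling := ('I_n.+1 -> option X).
Implicit Types (c d : labelling) (A B : {set 'I_n.+1}) (t : 'rV[R]_n.+1)
  (x : X).

Definition labelled c : {set 'I_n.+1} := [set i | isSome (c i)]%SET.
Definition restrict_labels c A : labelling := fun i => if i \in A then c i else None.
Definition supp t : {set 'I_n.+1} := [set i | t 0 i != 0]%SET.

Lemma labelled_restrict c A : A \subset labelled c ->
  labelled (restrict_labels c A) = A.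
Proof.
move=> /fintype.subsetP Ac; apply/finset.setP => i; rewrite inE /restrict_labels.
by case: ifP => // /Ac; rewrite inE.
Qed.

Lemma restrict_labelsS c A B : B \subset A ->
  restrict_labels (restrict_labels c A) B = restrict_labels c B.
Proof.
move=> /fintype.subsetP BA; apply/funext => i; rewrite /restrict_labels.
by case: ifP => // /BA ->.
Qed.

Lemma restrict_labelled c : restrict_labels c (labelled c) = c.
Proof.
by apply/funext => i; rewrite /restrict_labels inE; case: (c i).
Qed.

Lemma face_supp A t : face A t -> supp t \subset A.
Proof.
move=> [_ _ tA]; apply/fintype.subsetP => i; rewrite inE; apply: contraNT => /tA ->.
by rewrite eqxx.
Qed.

Lemma face_supp_neq0 A t : face A t -> supp t != finset.set0.
Proof.
move=> [_ t1 _]; apply/eqP => s0; have /eqP := t1.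
rewrite big1 => [|i _]; first by rewrite eq_sym oner_eq0.
have : i \notin supp t by rewrite s0 finset.in_set0.
by rewrite inE negbK => /eqP.
Qed.

Lemma faceS A B t : A \subset B -> face A t -> face B t.
Proof.
move=> /fintype.subsetP AB [t0 t1 tA]; split=> // i iB; apply: tA.
by apply: contra iB; exact: AB.
Qed.

Lemma face_supp_face A t : face A t -> face (supp t) t.
Proof. by move=> [t0 t1 _]; split=> // i; rewrite inE negbK => /eqP. Qed.

Lemma face_boundaryP A t : face A t ->
  face_boundary A t <-> supp t \proper A.
Proof.
move=> ft; rewrite properE (face_supp ft)/=; split.
  by move=> [_ [i iA ti]]; apply/fintype.subsetPn; exists i => //; rewrite inE ti eqxx.
move=> /fintype.subsetPn[i iA]; rewrite inE negbK => /eqP ti; split=> //.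
by exists i.
Qed.

(** The label at the highest labelled vertex. Labels are added in increasing order of vertices, so
    this is the point over which the newest simplices are filled. *)
Definition is_last c x : Prop := exists i,
  [/\ c i = Some x & forall k, k \in labelled c -> (k <= i)%N].

Lemma is_last_uniq c x x' : is_last c x -> is_last c x' -> x = x'.
Proof.
move=> [i [ci imax]] [i' [ci' imax']].
have ii' : i = i'.
  apply/val_inj/eqP; rewrite eqn_leq /= imax' ?imax// !inE ?ci ?ci'//.
by move: ci'; rewrite -ii' ci => -[].
Qed.

Definition fills c x (s g : 'rV[R]_n.+1 -> Y) := [/\
  {within face (labelled c), continuous g},
  g @` face (labelled c) `<=` phi #|labelled c|.-1 x &
  forall t, face_boundary (labelled c) t -> g t = s t].

(* Junk value: the constant map y0 when no filling exists. *)
Definition filling c (s : 'rV[R]_n.+1 -> Y) : 'rV[R]_n.+1 -> Y :=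
  xget (fun=> y0) [set g | exists2 x, is_last c x & fills c x s g].

(** The recursion runs on a bound for the number of labels. A point of the boundary has fewer
    vertices in its support than there are labels, so the previous stage already determines the map
    there. *)
Fixpoint skeletal_stage (m : nat) c : 'rV[R]_n.+1 -> Y :=
  if m is m'.+1 then
    if (#|labelled c| <= m')%N then skeletal_stage m' c
    else filling c (fun t => skeletal_stage m' (restrict_labels c (supp t)) t)
  else fun=> y0.

(* The map attached to a simplex whose vertices carry labels in X: it fills its
   own boundary, already determined by the labels of the proper faces, inside
   the value of phi at the last label. *)
Definition skeletal_map c := skeletal_stage n.+1 c.

Lemma skeletal_stage_eq m m' c : (#|labelled c| <= m)%N -> (m <= m')%N ->
  skeletal_stage m' c = skeletal_stage m c.
Proof.
move=> cm; elim: m' => [|m' IH]; first by rewrite leqn0 => /eqP ->.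
rewrite leq_eqVlt => /predU1P[->//|]; rewrite ltnS => mm' /=.
by rewrite (leq_trans cm mm') IH.
Qed.

Lemma skeletal_mapE c : labelled c != finset.set0 ->
  exists s, skeletal_map c = filling c s /\
    forall t, face_boundary (labelled c) t ->
      s t = skeletal_map (restrict_labels c (supp t)) t.
Proof.
rewrite -card_gt0 => c0.
have cn := card_set_ord (labelled c).
exists (fun t => skeletal_stage #|labelled c|.-1 (restrict_labels c (supp t)) t).
split.
  rewrite /skeletal_map (skeletal_stage_eq (leqnn _) cn).
  by rewrite -{1}(prednK c0) /= leqNgt prednK// leqnn.
move=> t bt; have pt : supp t \proper labelled c by apply/(face_boundaryP bt.1).
rewrite /skeletal_map (@skeletal_stage_eq #|labelled c|.-1 n.+1)//.
  by rewrite labelled_restrict ?fintype.proper_sub// -ltnS prednK// proper_card.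
by rewrite (leq_trans (leq_pred _)).
Qed.

(** Since [filling] may return a junk value, this records when the map on [A] is genuine:
    continuous, with values in the term of [phi] at [x] indexed by the dimension of [A], and
    coherent with the maps of the smaller faces. *)
Definition good_face c A x := [/\
  {within face A, continuous (skeletal_map (restrict_labels c A))},
  skeletal_map (restrict_labels c A) @` face A `<=` phi #|A|.-1 x &
  forall t, face_boundary A t -> skeletal_map (restrict_labels c A) t =
    skeletal_map (restrict_labels c (supp t)) t].

Definition good c x :=
  forall A, A \subset labelled c -> A != finset.set0 -> good_face c A x.

Lemma good_compat c x t : good c x -> face (labelled c) t ->
  skeletal_map c t = skeletal_map (restrict_labels c (supp t)) t.
Proof.
move=> gc ft; have [->|st] := eqVneq (supp t) (labelled c).
  by rewrite restrict_labelled.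
have bt : face_boundary (labelled c) t.
  by apply/(face_boundaryP ft); rewrite finset.properEneq st face_supp.
have c0 : labelled c != finset.set0.
  by apply: finset.subset_neq0 (face_supp_neq0 ft); exact: face_supp.
by have [_ _ /(_ _ bt)] := gc _ (subxx _) c0; rewrite restrict_labelled.
Qed.

Hypothesis phi_lc : forall k, (k <= n)%N -> lower_locally_constant (phi k).

(** Only the condition on values involves the point [x]. It says that [phi] contains the compact
    image of a face, which is an open condition by lower local constancy, and there are finitely
    many faces. *)
Lemma good_near c x : good c x -> \forall y \near x, good c y.
Proof.
move=> gc; suff : \forall y \near x, forall A, setT A ->
    A \subset labelled c -> A != finset.set0 -> good_face c A y.
  by apply: filterS => y gy A; exact: gy.
apply: (@filter_forall_finite _ _ _ _ (fun A y =>
  A \subset labelled c -> A != finset.set0 -> good_face c A y)) => [|A _].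
  exact: finite_finset.
have [Ac|Ac] := boolP (A \subset labelled c); last by apply: filterE.
have [->|A0] := eqVneq A finset.set0; first by apply: filterE.
have [cA imA compA] := gc _ Ac A0.
have An : (#|A|.-1 <= n)%N.
  by rewrite -ltnS prednK ?card_gt0// card_set_ord.
have oA := phi_lc An (continuous_compact cA (@face_compact R _ A)).
by apply: filterS (open_nbhs_nbhs (conj oA imA)) => y yA _ _; split.
Qed.

Hypothesis phi_neq0 : forall k, (k <= n)%N -> set_valued (phi k).
Hypothesis phi_asph : aspherical R n phi.

Definition add_label c (k : 'I_n.+1) x : labelling :=
  fun i => if i == k then Some x else c i.

(** Faces avoiding [k] are those of [c]. On a face containing [k] the new label is the last one,
    because [k] exceeds all labelled vertices, so the face is to be filled inside [phi] at [x]. By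
    induction on the size its facets are good at [x], and asphericity provides the filling. *)
Lemma good_add_label c (k : 'I_n.+1) x : good c x ->
  (forall i, i \in labelled c -> (i < k)%N) -> good (add_label c k x) x.
Proof.
move=> gc ck; set c' := add_label c k x.
have restrE A : k \notin A -> restrict_labels c' A = restrict_labels c A.
  move=> kA; apply/funext => i; rewrite /restrict_labels /c' /add_label.
  by case: ifP => // iA; case: eqP => // ik; rewrite -ik iA in kA.
move=> A; have [m] := ubnP #|A|; elim: m A => // m IH A Am Ac' A0.
have [kA|kA] := boolP (k \in A); last first.
  have Ac : A \subset labelled c.
    apply/fintype.subsetP => i iA; have := fintype.subsetP Ac' _ iA.
    rewrite !inE /c' /add_label.
    by case: eqP => // ik; rewrite -ik iA in kA.
  have [cA imA compA] := gc _ Ac A0; rewrite /good_face (restrE _ kA).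
  split=> // t bt; rewrite restrE ?compA//; apply: contra kA.
  exact: fintype.subsetP (face_supp bt.1) _.
set d := restrict_labels c' A; have dA : labelled d = A by exact: labelled_restrict.
have last_d : is_last d x.
  exists k; split; first by rewrite /d /restrict_labels kA /c' /add_label eqxx.
  move=> i; rewrite dA => /(fintype.subsetP Ac'); rewrite inE /c' /add_label.
  case: eqP => [->//|_ ci]; apply: ltnW; apply: ck; by rewrite inE.
have [|s [sE sbd]] := @skeletal_mapE d; first by rewrite dA.
(* Any filling will do: [xget] then returns some filling over a last label, and uniqueness of the
   last label identifies that point with [x]. *)
suff [g0 g0P] : exists g, fills d x s g.
  have : [set g | exists2 x, is_last d x & fills d x s g] (skeletal_map d).
    by rewrite sE; apply: xgetPex; exists g0; exists x.
  move=> [x' /(is_last_uniq last_d) <-] [cd imd bdd].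
  rewrite dA in cd imd bdd; split=> // t bt.
  rewrite bdd// sbd ?dA// restrict_labelsS//; exact: face_supp bt.1.
have IHf i : i \in A -> A :\ i != finset.set0 -> good_face c' (A :\ i) x.
  move=> iA; apply: IH.
    by rewrite ltnS in Am; apply: leq_trans Am; rewrite [#|A|](cardsD1 i) iA.
  exact: fintype.subset_trans (finset.subsetDl _ _) Ac'.
(* On each facet the prescribed boundary values are the map of that facet, also at points of lower
   faces, by the coherence of good facets. *)
have sE' i t : i \in A -> face (A :\ i) t ->
    s t = skeletal_map (restrict_labels c' (A :\ i)) t.
  move=> iA ft; have bt : face_boundary A t.
    apply/face_boundaryP; first by apply: faceS ft; exact: finset.subsetDl.
    by apply: fintype.sub_proper_trans (face_supp ft) (finset.properD1 iA).
  rewrite sbd ?dA// restrict_labelsS ?(face_supp bt.1)//.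
  have [->//|st] := eqVneq (supp t) (A :\ i).
  have Ai0 : A :\ i != finset.set0.
    by apply: finset.subset_neq0 (face_supp_neq0 ft); exact: face_supp.
  have [_ _ ->//] := IHf _ iA Ai0.
  by apply/(face_boundaryP ft); rewrite finset.properEneq st face_supp.
have bdE t : face_boundary A t -> exists2 i, i \in A & face (A :\ i) t.
  move=> [[t0 t1 tA] [i iA ti]]; exists i => //; split=> // l.
  by rewrite !inE negb_and negbK => /orP[/eqP->|/tA].
(* For a single vertex the boundary is empty and any value in [phi 0 x] fills it. *)
have [A1|] := leqP #|A| 1.
  have [y phiy] := phi_neq0 (leq0n n) x.
  have A1' : #|A| = 1 by apply/eqP; rewrite eqn_leq A1 card_gt0.
  exists (fun=> y); split; rewrite ?dA.
  - by apply: continuous_subspaceT; exact: cst_continuous.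
  - by move=> _ [t _ <-]; rewrite A1'.
  - move=> t /bdE[i iA ft]; have := face_supp_neq0 ft.
    have := face_supp ft; have /eqP-> : A :\ i == finset.set0.
      by rewrite -finset.cards_eq0; move: A1'; rewrite (cardsD1 i) iA add1n => -[->].
    by rewrite finset.subset0 => ->.
move=> A_gt1; have [j Aj] : exists j, #|A| = j.+2.
  by exists #|A|.-2; case: #|A| A_gt1 => [|[]].
have An := card_set_ord A.
have jn : (j < n)%N by rewrite Aj in An.
have card_face i : i \in A -> #|A :\ i| = j.+1.
  by move=> iA; move: Aj; rewrite (cardsD1 i) iA add1n => -[].
have face0 i : i \in A -> A :\ i != finset.set0.
  by move=> iA; rewrite -card_gt0 card_face.
have [||g [cg img gs]] := @face_extension R n.+1 j A Y _ _ s Aj (@phi_asph j jn x).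
(* The boundary is a finite union of closed facets, so the boundary values are continuous by
   pasting. *)
- have -> : face_boundary A = \bigcup_(i in [set` enum A]) @face R _ (A :\ i).
    apply/seteqP; split=> [t /bdE[i iA ft]|t [i /=]].
      by exists i => //=; rewrite mem_enum.
    rewrite mem_enum => iA ft; apply/face_boundaryP.
      by apply: faceS ft; exact: finset.subsetDl.
    by apply: fintype.sub_proper_trans (face_supp ft) (finset.properD1 iA).
  apply: within_continuous_bigcup => i; rewrite mem_enum => iA.
    exact: face_closed.
  have [ci _ _] := IHf i iA (face0 _ iA).
  by apply: within_continuous_eq ci => t ft; rewrite -sE'.
- move=> _ [t /bdE[i iA ft] <-]; rewrite (sE' _ _ iA ft).
  have [_ imi _] := IHf i iA (face0 _ iA).
  by have := imi _ (ex_intro2 _ _ t ft erefl); rewrite card_face.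
by exists g; rewrite /fills dA Aj.
Qed.

Lemma good_unlabelled c x : labelled c = finset.set0 -> good c x.
Proof. by move=> c0 A; rewrite c0 finset.subset0 => ->. Qed.

(** Extend the constant map at [y] from the sphere to the ball: the extension takes the value [y] on
    the sphere and has its values in the next term. Thus an aspherical sequence is increasing. *)
Lemma aspherical_sub k m x : (k <= m <= n)%N -> phi k x `<=` phi m x.
Proof.
elim: m => [|m IH] /andP[km mn].
  by move: km; rewrite leqn0 => /eqP->.
move: km; rewrite leq_eqVlt => /predU1P[->//|]; rewrite ltnS => km y ky.
have phimy : phi m x y by apply: IH ky; rewrite km ltnW.
have [||g [_ img gE]] := @phi_asph m mn x (fun=> y).
- by apply: continuous_subspaceT; exact: cst_continuous.
- by move=> _ [_ _ <-].
have Su := @sphere_delta R m.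
have <- := gE _ Su; apply: img; exists (delta_mx 0 ord0) => //.
by rewrite /cball/= Su.
Qed.

End SkeletalMaps.

(** * Locally finite layers of labels *)

Section Layers.
Variable X : topologicalType.
Hypotheses (hX : hausdorff_space X) (pX : paracompact X).

(** [L x] is the set of labels active at [x]. No new label becomes active near [x], and some label
    is active on a whole neighbourhood of [x]. *)
Definition layer (L : X -> set X) := [/\ forall x, finite_set (L x),
  forall x, \forall y \near x, L y `<=` L x &
  forall x : X, exists c, \forall y \near x, L y c].

(** Choose a locally finite refinement with closures inside sets [Q c], and let a label be active on
    the closures of the members assigned to it. Closedness excludes new labels nearby; openness of
    the members gives a label active on a neighbourhood. *)
Lemma exists_layer (Q : X -> set X) : (forall x, open (Q x) /\ Q x x) ->
  exists L, layer L /\ forall x c, L x c -> Q c x.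
Proof.
move=> oQ; have [[x0 _]|noX] := pselect (exists x : X, True); last first.
  exists (fun=> set0); split=> //; split=> x; try by case: noX; exists x.
pose CC : set (set X) := [set G | open G /\ exists c, closure G `<=` Q c].
have cCC : open_cover CC.
  split; first by move=> G [].
  apply/seteqP; split=> // x _; have [oQx Qx] := oQ x.
  have [||G [oG Gx GQ]] := @paracompact_regular _ pX hX x (~` Q x).
  - exact: open_closedC.
  - exact.
  exists G => //; split=> //; exists x.
  by move/disjoints_subset: GQ; rewrite setCK.
have [VV [[oV cV] rV lfV]] := pX cCC.
have [alpha alphaP] : {alpha : set X -> X |
    forall V, VV V -> closure V `<=` Q (alpha V)}.
  suff : forall V, {c | VV V -> closure V `<=` Q c}.
    by move=> h; exists (fun V => sval (h V)) => V; case: (h V).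
  move=> V; have [VV_V|nV] := pselect (VV V); last by exists x0.
  suff /cid[c cP] : exists c, closure V `<=` Q c by exists c.
  have [G [_ [c GQ]] VG] := rV _ VV_V; exists c.
  exact: subset_trans (closureS VG) GQ.
pose L x := alpha @` [set V | VV V /\ closure V x].
have closN (N V : set X) x : open N -> N x -> closure V x -> V `&` N !=set0.
  by move=> oN Nx; apply; exact: open_nbhs_nbhs.
exists L; split; last by move=> x _ [V [VV_V clV] <-]; exact: alphaP.
split=> x.
- have [N [oN Nx fN]] := locally_finite_open x lfV.
  apply: finite_image; apply: sub_finite_set fN => V [VV_V clV].
  by split=> //; exact: closN clV.
- have [N [oN Nx fN]] := locally_finite_open x lfV.
  have nV : \forall y \near x, forall V, [set V | VV V /\ V `&` N !=set0] V ->
      closure V y -> closure V x.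
    apply: (@filter_forall_finite _ _ _ _ (fun V y => closure V y -> closure V x)) => //.
    move=> V _; have [clV|nclV] := pselect (closure V x); first exact: filterE.
    have oC : open (~` closure V) by exact/closed_openC/closed_closure.
    by apply: filterS (open_nbhs_nbhs (conj oC nclV)) => y ny /ny.
  apply: filterS2 nV (open_nbhs_nbhs (conj oN Nx)) => y yV Ny _ [V [VV_V clV] <-].
  by exists V => //; split=> //; exact: yV (conj VV_V (closN _ _ _ oN Ny clV)) clV.
- have : [set: X] x by []; rewrite -cV => -[V VV_V Vx]; exists (alpha V).
  apply: filterS (open_nbhs_nbhs (conj (oV _ VV_V) Vx)) => y Vy.
  by exists V => //; split=> //; exact: subset_closure.
Qed.

Lemma finite_labellings (k : nat) (S : set X) : finite_set S ->
  finite_set [set c : 'I_k -> option X | forall i y, c i = Some y -> S y].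
Proof.
move=> /finite_seqP[s ->].
pose lab (g : {ffun 'I_k -> 'I_(size s).+1}) : 'I_k -> option X :=
  fun i => nth None (map Some s) (g i).
apply: (sub_finite_set (B := lab @` setT)); last first.
  by apply: finite_image; exact: finite_finset.
(* The index [size s] lies beyond the list and encodes [None]. *)
move=> c cs; exists [ffun i => inord
  (if c i is Some y then index y s else size s)] => //.
apply/funext => i; rewrite /lab ffunE; case ci: (c i) => [y|].
  have ys : y \in s by exact: cs ci.
  by rewrite inordK ?ltnS ?index_size// (nth_map y) ?index_mem// nth_index.
by rewrite inordK// nth_default// size_map.
Qed.

Variables (R : realType) (n : nat) (Y : topologicalType) (y0 : Y)
  (phi : nat -> X -> set Y).
Hypothesis phi_lc : forall k, (k <= n)%N -> lower_locally_constant (phi k).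
Hypothesis phi_neq0 : forall k, (k <= n)%N -> set_valued (phi k).
Hypothesis phi_asph : aspherical R n phi.

Definition active (L : nat -> X -> set X) (c : 'I_n.+1 -> option X) (x : X) :=
  forall i y, c i = Some y -> L i x y.

(** Induction on the number [m] of layers. By local finiteness only finitely many labellings by the
    old layers are active at [x]; each remains good at all points near [x] after [x] is added as its
    label at vertex [m]. The new layer is subordinate to these neighbourhoods. *)
Lemma exists_layers : exists L : nat -> X -> set X,
  (forall i, (i <= n)%N -> layer (L i)) /\
  forall c x, active L c x -> good R y0 phi c x.
Proof.
suff /(_ n.+1 (leqnn _))[L [layL goodL]] : forall m, (m <= n.+1)%N ->
    exists L : nat -> X -> set X, (forall i, (i < m)%N -> layer (L i)) /\
    forall c x, (forall i, i \in labelled c -> (i < m)%N) -> active L c x ->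
      good R y0 phi c x.
  by exists L; split=> // c x; apply: goodL.
elim=> [_|m IH mn].
  exists (fun _ _ => set0); split=> // c x c0 _; apply: good_unlabelled.
  by apply/finset.setP => i; rewrite finset.in_set0; apply/negP => /c0.
have [L [layL goodL]] := IH (ltnW mn).
pose k : 'I_n.+1 := Ordinal mn.
pose old (c : 'I_n.+1 -> option X) := forall i, i \in labelled c -> (i < m)%N.
(* [x] is the prospective label, [y] the point at which it is active. The first clause ensures that
   old labels active at [y] were active at [x], and so took part in the second clause. *)
pose P x y := (forall i, `I_m i -> L i y `<=` L i x) /\
  forall c, old c /\ active L c x -> good R y0 phi (add_label c k x) y.
have nP x : \forall y \near x, P x y.
  apply: filterI.
    apply: (@filter_forall_finite _ _ _ _ (fun i y => L i y `<=` L i x)) => [|i im].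
      exact: finite_II.
    by have [_ + _] := layL _ im; apply.
  apply: (@filter_forall_finite _ _ _ [set c | old c /\ active L c x]
    (fun c y => good R y0 phi (add_label c k x) y)) => [|c [oc ac]].
    have fS : finite_set (\bigcup_(i in `I_m) L i x).
      apply: bigcup_finite; first exact: finite_II.
      by move=> i im; have [+ _ _] := layL _ im; apply.
    apply: sub_finite_set (finite_labellings n.+1 fS) => c [oc ac] i y ci.
    by exists i; [apply: oc; rewrite inE ci|exact: ac].
  apply: good_near => //; apply: good_add_label => //.
  exact: goodL.
have [|L' [layL' L'P]] := @exists_layer (fun x => (P x)°).
  by move=> x; split; [exact: open_interior|exact: nP].
exists (fun i => if i == m then L' else L i); split.
  move=> i; rewrite ltnS leq_eqVlt; case: eqP => //= _; exact: layL.
move=> c x cm ac; case ck: (c k) => [y|]; last first.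
  apply: goodL => [i ic|i y ci].
    have := cm _ ic; rewrite ltnS leq_eqVlt => /predU1P[im|//].
    have ik : i = k by exact: val_inj.
    by move: ic; rewrite inE ik ck.
  have := ac _ _ ci; case: eqP => // im; have ik : i = k by exact: val_inj.
  by rewrite ik ck in ci.
(* Here the label is [y] and the point is [x]: the old part [c0] of [c] is active at [x], hence at
   [y], and adding [y] to it is good at [x]. *)
have /L'P/interior_subset[Lsub goodP] : L' x y.
  by have := ac _ _ ck; rewrite eqxx.
pose c0 i := if i == k then None else c i.
have -> : c = add_label c0 k y.
  by apply/funext => i; rewrite /add_label /c0; case: eqP => // ->.
have oc0 : old c0.
  move=> i; rewrite inE /c0; case: eqP => // /eqP ik ci.
  have := cm i; rewrite inE ci ltnS leq_eqVlt => /(_ isT)/predU1P[im|//].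
  by case/negP: ik; apply/eqP; exact: val_inj.
apply: goodP; split=> // i z c0i; apply: Lsub.
  by apply: oc0; rewrite inE c0i.
have := c0i; rewrite /c0; case: eqP => // /eqP ik ci.
by have := ac _ _ ci; case: eqP => // im; case/negP: ik; apply/eqP; exact: val_inj.
Qed.

End Layers.

(** * The continuous selection *)

Section Selection.
Variables (R : realType) (X : topologicalType) (n : nat).
Hypotheses (hX : hausdorff_space X) (pX : paracompact X) (dX : dim_le X n).

Lemma dim_selection (Y : topologicalType) (phi : nat -> X -> set Y) :
  (forall k, (k <= n)%N -> set_valued (phi k)) ->
  (forall k, (k <= n)%N -> lower_locally_constant (phi k)) ->
  aspherical R n phi -> exists f : X -> Y, continuous f /\ selection (phi n) f.
Proof.
move=> phi_neq0 phi_lc phi_asph.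
have [[x0 _]|noX] := pselect (exists x : X, True); last first.
  pose f x : Y := False_rect Y (noX (ex_intro _ x I)).
  by exists f; split=> x; have [] := noX (ex_intro _ x I).
have [y0 _] := phi_neq0 0%N (leq0n n) x0.
have [L [layL goodL]] := exists_layers hX pX y0 phi_lc phi_neq0 phi_asph.
(* Over a member of this cover one label from each of the [n.+1] layers is active throughout. *)
pose CC : set (set X) := [set G | open G /\ exists c : 'I_n.+1 -> X,
  forall x (i : 'I_n.+1), G x -> L i x (c i)].
have cCC : open_cover CC.
  split; first by move=> G [].
  apply/seteqP; split=> // x _.
  have [c cP] : {c : 'I_n.+1 -> X | forall i : 'I_n.+1, \forall y \near x, L i y (c i)}.
    suff h (i : 'I_n.+1) : {c | \forall y \near x, L i y c}.
      by exists (fun i => sval (h i)) => i; case: (h i).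
    by apply: cid; have [|_ _] := layL i; first by rewrite -ltnS.
  have nc : \forall y \near x, forall i : 'I_n.+1, setT i -> L i y (c i).
    apply: (@filter_forall_finite _ _ _ _
      (fun (i : 'I_n.+1) y => L i y (c i))) => [|i _].
      exact: finite_finset.
    exact: cP.
  exists ([set y | forall i : 'I_n.+1, setT i -> L i y (c i)]°) => //.
  split; first exact: open_interior.
  by exists c => y i /interior_subset; apply.
have [VV [xi [VC dV cxi sum_xi xi_cov]]] := dim_partition_of_unity R hX pX dX cCC.
have [alpha alphaP] : {alpha : set X -> 'I_n.+1 -> X |
    forall k V, VV k V -> forall x (i : 'I_n.+1), V x -> L i x (alpha V i)}.
  suff : forall V, {c : 'I_n.+1 -> X | (exists k, VV k V) ->
      forall x (i : 'I_n.+1), V x -> L i x (c i)}.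
    move=> h; exists (fun V => sval (h V)) => k V kV.
    by case: (h V) => /= c; apply; exists k.
  move=> V; have [kV|nkV] := pselect (exists k, VV k V); last by exists (fun=> x0).
  suff /cid[c cP] : exists c : 'I_n.+1 -> X,
      forall x (i : 'I_n.+1), V x -> L i x (c i).
    by exists c.
  have [k /VC[_ [G [_ [c cP]] VG]]] := kV.
  by exists c => x i /VG; exact: cP.
(* Vertex [k] receives the layer [k] label of the only member of [VV k] containing [x], if there is
   one. All these labels are active at [x], so [C x] is good at [x]. *)
pose C x (k : 'I_n.+1) := if pselect (exists V, VV k V /\ V x) is left e
  then Some (alpha (sval (cid e)) k) else None.
have C_in k V x : VV k V -> V x -> C x k = Some (alpha V k).
  move=> kV Vx; rewrite /C; case: pselect => [e|]; last by case; exists V.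
  by case: (cid e) => W [kW Wx] /=; rewrite (dV k W V x).
have C_out k x : ~ (exists V, VV k V /\ V x) -> C x k = None.
  by rewrite /C; case: pselect.
have C_good x : good R y0 phi (C x) x.
  apply: goodL => i y; rewrite /C; case: pselect => // e [<-].
  by case: (cid e) => W [kW Wx] /=; exact: alphaP kW _ _ Wx.
have labelledC x k : k \in labelled (C x) <-> exists V, VV k V /\ V x.
  rewrite inE; split=> [|[V [kV Vx]]]; last by rewrite (C_in _ _ _ kV Vx).
  by apply: contraPP => /C_out ->.
pose Xi x : 'rV[R]_n.+1 := \row_k xi k x.
have Xi_face x : face (labelled (C x)) (Xi x).
  split=> [k||k kC]; first by rewrite mxE; have [_] := cxi k.
    by under eq_bigr do rewrite mxE.
  rewrite mxE; have [[V kV Vx]|/nbhs_singleton//] := xi_cov k x.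
  by case/negP: kC; apply/labelledC; exists V.
have Xi_cont : continuous Xi.
  move=> x; apply: (@cvg_rV _ _ (nbhs x)) => k; rewrite mxE.
  rewrite (_ : (fun x => _) = xi k); first by have [+ _] := cxi k; apply.
  by apply/funext => y; rewrite mxE.
(* Labels of vertices with weight zero are dropped, so that a label appearing or disappearing near
   [x] does not affect the value. *)
exists (fun x => skeletal_map y0 phi (restrict_labels (C x) (supp (Xi x))) (Xi x)).
split; last first.
  move=> x; have s0 := face_supp_neq0 (Xi_face x).
  have [_ im _] := C_good x _ (face_supp (Xi_face x)) s0.
  have : (#|supp (Xi x)|.-1 <= n <= n)%N.
    by rewrite leqnn andbT -ltnS prednK ?card_gt0// card_set_ord.
  move/(aspherical_sub phi_asph); apply; apply: im; exists (Xi x) => //.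
  exact: face_supp_face (Xi_face x).
move=> x; pose c := C x.
(* Near [x] the vertices labelled at [x] keep their labels, and the weights of all others vanish.
   Hence the fixed labelling [c] computes the selection on a neighbourhood. *)
have near_c : \forall y \near x, forall k, setT k ->
    (k \in labelled c -> C y k = c k) /\ (k \notin labelled c -> xi k y = 0).
  apply: (@filter_forall_finite _ _ _ _ (fun k y =>
    (k \in labelled c -> C y k = c k) /\ (k \notin labelled c -> xi k y = 0))).
    exact: finite_finset.
  move=> k _; have [kc|kc] := boolP (k \in labelled c).
    have [V [kV Vx]] := iffLR (labelledC x k) kc; have [oV _] := VC _ _ kV.
    apply: filterS (open_nbhs_nbhs (conj oV Vx)) => y Vy; split=> // _.
    by rewrite /c (C_in _ _ _ kV Vx) (C_in _ _ _ kV Vy).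
  have [[V kV Vx]|] := xi_cov k x.
    by case/negP: kc; apply/labelledC; exists V.
  by apply: filterS => y yk; split.
have near_f : \forall y \near x, face (labelled c) (Xi y) /\
    skeletal_map y0 phi (restrict_labels (C y) (supp (Xi y))) (Xi y) =
    skeletal_map y0 phi c (Xi y).
  apply: filterS near_c => y yc.
  have fy : face (labelled c) (Xi y).
    have [X0 X1 _] := Xi_face y; split=> // k kc; rewrite mxE.
    by have [_ ->] := yc k I.
  split=> //; rewrite (good_compat (C_good x) fy); congr (skeletal_map _ _ _ _).
  apply/funext => k; rewrite /restrict_labels; case: ifP => // ks.
  by have [->//] := yc k I; exact: fintype.subsetP (face_supp fy) _ ks.
have [fx fxE] := nbhs_singleton near_f.
have c0 : labelled c != finset.set0.
  exact: finset.subset_neq0 (face_supp fx) (face_supp_neq0 fx).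
have [+ _ _] := C_good x _ (fintype.subxx _) c0.
rewrite restrict_labelled => /subspace_continuousP/(_ _ fx) csk W.
rewrite fxE => /csk Wsk.
have := Xi_cont x _ Wsk; rewrite /= => nW.
apply: filterS2 near_f nW => y [fy fE] nWy.
by have : W (skeletal_map y0 phi c (Xi y)) := nWy fy; rewrite -fE.
Qed.

End Selection.

(** * Barycentric coordinates *)

Section SimplexCoordinates.
Variables (R : realType) (V : choiceType).
Local Notation E := (free_normed R V).
Implicit Types (t u : E) (s : {fset V}) (v : V).

Lemma coordD t u v : (t + u) v = t v + u v. Proof. by []. Qed.

Lemma coordZ (a : R) t v : (a *: t) v = a * t v. Proof. by []. Qed.

Lemma coordB t u v : (t - u) v = t v - u v. Proof. by []. Qed.

Lemma coord_vertex v w : vertex R v w = (w == v)%:R. Proof. by []. Qed.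

Lemma coord_sum (r : seq V) (a : V -> R) (x : V -> E) w :
  (\sum_(v <- r) a v *: x v) w = \sum_(v <- r) a v * x v w.
Proof. exact: (big_morph (fun t : E => t w)). Qed.

Lemma l1norm_seq s t : (forall v, v \notin s -> t v = 0) ->
  `|t| = \sum_(v <- s) `|t v|.
Proof.
move=> ts; rewrite [LHS](@l1normE _ _ [set` s]); last first.
  by move=> v /=; apply: contraNP => /negP /ts ->.
by rewrite fsbig_finite ?set_fsetK//; exact: finite_fset.
Qed.

Lemma coord_le_norm t v : `|t v| <= `|t|.
Proof.
have [->|tv] := eqVneq (t v) 0; first by rewrite normr0.
rewrite (@l1norm_seq (fset_set [set v | t v != 0])) => [|w]; last first.
  rewrite in_fset_set; last exact: finite_coord.
  by rewrite notin_setE /= => /negP; rewrite negbK => /eqP.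
rewrite (bigD1_seq v)//= ?lerDl ?sumr_ge0//.
by rewrite in_fset_set ?inE//; exact: finite_coord.
Qed.

Lemma coord_cont v : continuous (fun t => t v : R).
Proof.
move=> t W /nbhs_ballP[e e0 eW]; apply/nbhs_ballP; exists e => // u.
rewrite -ball_normE /= => tu; apply: eW; rewrite -ball_normE /= -coordB.
exact: le_lt_trans (coord_le_norm _ _) tu.
Qed.

Definition barycentric s : set E := [set t | [/\ forall v, 0 <= t v,
  forall v, v \notin s -> t v = 0 & \sum_(v <- s) t v = 1]].

Lemma barycentric_sum s t : (forall v, v \notin s -> t v = 0) ->
  t = \sum_(v <- s) t v *: vertex R v.
Proof.
move=> ts; apply/val_inj/funext => w; rewrite [RHS]coord_sum.
have [ws|ws] := boolP (w \in s); last first.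
  rewrite [LHS]ts// big_seq big1// => v vs; rewrite coord_vertex.
  by case: eqP => [wv|_]; rewrite ?mulr0//; rewrite wv vs in ws.
rewrite (bigD1_seq w)//= big1 ?addr0 => [|v vw].
  by rewrite /= eqxx mulr1.
by rewrite /= eq_sym (negbTE vw) mulr0.
Qed.

Lemma convex_set_sum (A : set E) (r : seq V) (a : V -> R) (x : V -> E) :
  convex_set A -> (forall v, v \in r -> 0 <= a v) -> \sum_(v <- r) a v = 1 ->
  (forall v, v \in r -> A (x v)) -> A (\sum_(v <- r) a v *: x v).
Proof.
move=> cA; elim: r a => [|v r IH] a a0.
  by rewrite big_nil => /eqP; rewrite eq_sym oner_eq0.
rewrite !big_cons => a1 Ax; set b := \sum_(w <- r) a w in a1.
have b0 : 0 <= b.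
  by rewrite /b big_seq sumr_ge0// => w wr; apply: a0; rewrite inE wr orbT.
have Axr w : w \in r -> A (x w) by move=> wr; apply: Ax; rewrite inE wr orbT.
have ar w : w \in r -> 0 <= a w by move=> wr; apply: a0; rewrite inE wr orbT.
have av0 : 0 <= a v by apply: a0; exact: mem_head.
have [bz|bz] := eqVneq b 0.
  have az w : w \in r -> a w = 0.
    move=> wr; apply/eqP; move: (bz); rewrite /b big_seq => /eqP.
    rewrite psumr_eq0// => /allP/(_ _ wr); rewrite wr; exact.
  rewrite big_seq big1 => [|w wr]; last by rewrite az// scale0r.
  by rewrite addr0; move: a1; rewrite bz addr0 => ->; rewrite scale1r; exact/Ax/mem_head.
have av1 : a v <= 1 by rewrite -a1 lerDl.
have Ay : A (\sum_(w <- r) (a w / b) *: x w).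
  apply: IH => //; first by move=> w wr; rewrite divr_ge0// ar.
  by rewrite -mulr_suml mulfV.
suff : A (a v *: x v + (1 - a v) *: \sum_(w <- r) (a w / b) *: x w).
  rewrite -a1 addrAC subrr add0r scaler_sumr; congr (A (_ + _)).
  by apply: eq_bigr => w _; rewrite scalerA mulrC mulfVK.
exact/set_mem/(cA _ _ (Itv01 av0 av1) (mem_set (Ax _ (mem_head _ _))) (mem_set Ay)).
Qed.

Lemma simplexE s : simplex s = barycentric s.
Proof.
apply/seteqP; split.
  apply: smallest_sub => [x y l /set_mem[x0 xs x1] /set_mem[y0 ys y1]|].
    suff : barycentric s (l%:num *: (x : E) + (1 - l%:num) *: (y : E)).
      by move=> ?; exact: mem_set.
    have l0 : 0 <= l%:num :> R by [].
    have l1 : 0 <= 1 - l%:num :> R by rewrite subr_ge0.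
    split=> [v|v vs|].
    - by rewrite coordD !coordZ addr_ge0// mulr_ge0.
    - by rewrite coordD !coordZ xs// ys// !mulr0 addr0.
    - under eq_bigr do rewrite coordD !coordZ.
      by rewrite big_split/= -!mulr_sumr x1 y1 !mulr1 addrC subrK.
  move=> _ [v vs <-]; split=> [w|w ws|].
  - by rewrite coord_vertex ler0n.
  - by rewrite coord_vertex; case: eqP => // wv; rewrite wv (vs : v \in s) in ws.
  - rewrite (bigD1_seq v)//= eqxx big1 ?addr0// => w wv.
    by rewrite /= (negbTE wv).
move=> t [t0 ts t1] A [cA vA]; rewrite (barycentric_sum ts).
by apply: convex_set_sum => // v vs; apply: vA; exists v.
Qed.

Lemma affine_hull_simplex s t : affine_hull (simplex s) t ->
  (forall v, v \notin s -> t v = 0) /\ \sum_(v <- s) t v = 1.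
Proof.
move=> /(_ [set t | (forall v, v \notin s -> t v = 0) /\ \sum_(v <- s) t v = 1]).
apply; split; last by rewrite simplexE => u [_ us u1]; split.
move=> x y a [xs x1] [ys y1]; split=> [v vs|].
  by rewrite coordD !coordZ xs// ys// !mulr0 addr0.
under eq_bigr do rewrite coordD !coordZ.
by rewrite big_split/= -!mulr_sumr x1 y1 !mulr1 subrK.
Qed.

Lemma open_simplexP s t :
  open_simplex s t <-> barycentric s t /\ forall v, v \in s -> 0 < t v.
Proof.
pose H := affine_hull (simplex (R := R) s).
have sH u : simplex s u -> H u by move=> su A [_]; apply.
split=> [[st it]|[bt tpos]].
  have bt := st; rewrite simplexE in bt; split=> // v vs.
  have [t0 ts t1] := bt; rewrite lt_def t0 andbT; apply/eqP => tv.
  have [W nt WH] := iffLR (nbhs_subspace_ex _ (sH _ st)) it.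
  have sv : simplex s (vertex R v) by move=> A [_]; apply; exists v.
  pose d := t - vertex R v.
  have [e /= e0 be] := iffLR (nbhs_ballP _ _) nt.
  (* If the coordinate at [v] were 0, a small step away from the vertex [v] would stay in the affine
     hull but make that coordinate [- r]. The summand 1 keeps the step shorter than [e] without
     assuming [d] nonzero. *)
  pose r := e / (1 + `|d|).
  have r0 : 0 < r by rewrite divr_gt0// ltr_pwDl.
  pose u : E := (1 - - r) *: t + - r *: vertex R v.
  have uE : u = t + r *: d.
    by rewrite /u opprK scalerDl scale1r scaleNr scalerBr addrA.
  have Hu : H u.
    move=> A hA; have [aA _] := hA.
    by apply: aA; [exact: sH st _ hA|exact: sH sv _ hA].
  have Wu : W u.
    apply: be; rewrite -ball_normE /= uE opprD addrA subrr sub0r normrN normrZ.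
    rewrite gtr0_norm//.
    rewrite /r mulrAC ltr_pdivrMr ?ltr_pwDl// ltr_pM2l//.
    by rewrite ltrDr.
  have [su _] : (simplex s `&` H) u by rewrite WH.
  move: su; rewrite simplexE => -[/(_ v) + _ _].
  rewrite uE coordD coordZ coordB coord_vertex eqxx tv sub0r add0r mulrN1.
  by rewrite oppr_ge0 leNgt r0.
have st : simplex s t by rewrite simplexE.
split=> //; apply/(nbhs_subspace_ex _ (sH _ st)).
(* Near [t] the finitely many coordinates in [s] remain positive, so a nearby point of the affine
   hull belongs to the simplex. *)
exists (~` H `|` simplex s); last first.
  by apply/seteqP; split=> u [su Hu]; split=> //; [right|case: su].
have npos : \forall u \near t, forall v, [set` s] v -> 0 < (u : E) v.
  apply: (@filter_forall_finite E V (nbhs t) [set` s]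
    (fun v (u : E) => 0 < u v) _) => [|v vs].
    exact: finite_fset.
  by have := @coord_cont v t; move=> /cvgr_gt; apply; exact: tpos.
apply: filterS npos => u upos; have [Hu|] := pselect (H u); last by left.
right; have [us u1] := affine_hull_simplex Hu.
rewrite simplexE; split=> // v; have [vs|/us->//] := boolP (v \in s).
exact/ltW/upos.
Qed.

Lemma simplex_closed s : closed (simplex (R := R) s).
Proof.
have -> : simplex s = (\bigcap_v [set t : E | 0 <= t v]) `&`
    (\bigcap_(v in [set v | v \notin s]) [set t : E | t v = 0]) `&`
    [set t : E | \sum_(v <- s) t v = 1].
  rewrite simplexE; apply/seteqP; split=> [t [t0 ts t1]|t [[t0 ts] t1]].
    by split=> //; split=> // v _; exact: t0.
  by split=> // v; exact: t0.
apply: closedI; first apply: closedI.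
- apply: closed_bigI => v _.
  suff : closed ((fun t : E => t v : R) @^-1` [set x | 0 <= x]) by [].
  by apply: preimage_closed => [t _|]; [exact: coord_cont|exact: closed_ge].
- apply: closed_bigI => v _.
  suff : closed ((fun t : E => t v : R) @^-1` [set 0]) by [].
  by apply: preimage_closed => [t _|]; [exact: coord_cont|exact: closed_eq].
- suff : closed ((fun t : E => \sum_(v <- s) t v : R) @^-1` [set 1]) by [].
  apply: preimage_closed => [t _|]; last exact: closed_eq.
  apply: continuous_big => [|v _]; first exact: add_continuous.
  exact: coord_cont.
Qed.

End SimplexCoordinates.

(** * Geometric realisations *)

Section RealisationTopology.
Variables (R : realType) (V : choiceType) (Sigma : simplicial_complex V).
Local Notation E := (free_normed R V).
Local Notation K := (realisation R Sigma).
Implicit Types (p q : K) (v : V) (s : {fset V}).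

Definition point_of p : E := set_val (p : polyhedron Sigma).
(** The support of the barycentric coordinates is a simplex of the complex ([carrier_simplex]), and
    membership in open stars is read off from it ([open_starP]). *)
Definition carrier p : {fset V} := fset_set [set v | point_of p v != 0].

Lemma point_of_inj : injective point_of. Proof. exact: val_inj. Qed.

Lemma in_carrier p v : (v \in carrier p) = (point_of p v != 0).
Proof.
rewrite in_fset_set; last exact: finite_coord.
by apply/idP/idP; [move/set_mem|move/mem_set].
Qed.

Lemma realisation_of t : polyhedron Sigma t -> exists p, point_of p = t.
Proof. by move=> pt; exists (SigSub (mem_set pt)). Qed.

Lemma point_ofP p : exists2 s, simplices Sigma s & barycentric s (point_of p).
Proof.
have : polyhedron Sigma (point_of p) by exact: set_valP.
by move=> [s Ss]; rewrite simplexE; exists s.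
Qed.

Lemma carrier_sub p s : barycentric s (point_of p) -> (carrier p `<=` s)%fset.
Proof.
move=> [_ ps _]; apply/fsubsetP => v; rewrite in_carrier.
by apply: contraNT => /ps ->.
Qed.

Lemma sum_carrier p s (F : V -> R) : (carrier p `<=` s)%fset ->
  \sum_(v <- s) F v * point_of p v = \sum_(v <- carrier p) F v * point_of p v.
Proof.
move=> cs; rewrite (big_fsetID _ (fun v => v \in carrier p))/=.
rewrite [X in _ + X]big_seq [X in _ + X]big1 ?addr0 => [|v]; last first.
  by rewrite !inE /= in_carrier negbK => /andP[_ /eqP->]; rewrite mulr0.
apply: perm_big; apply: uniq_perm; rewrite ?fset_uniq// => v.
by rewrite !inE /=; apply: andb_idl; exact: (fsubsetP cs).
Qed.

Lemma carrier_barycentric p : barycentric (carrier p) (point_of p).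
Proof.
have [s Ss bs] := point_ofP p; have [p0 ps p1] := bs.
split=> // [v|]; first by rewrite in_carrier negbK => /eqP.
have := sum_carrier (fun=> 1) (carrier_sub bs).
by rewrite -!mulr_sumr !mul1r p1 => <-.
Qed.

Lemma carrier_simplex p : simplices Sigma (carrier p).
Proof.
have [s Ss bs] := point_ofP p; apply: simplex_sub Ss _ (carrier_sub bs).
apply/eqP => c0; have [_ _] := carrier_barycentric p.
by rewrite c0 big_nil => /eqP; rewrite eq_sym oner_eq0.
Qed.

Lemma open_starP v p : open_star v p <-> v \in carrier p.
Proof.
split=> [[s [Ss vs /open_simplexP[_ /(_ _ vs) pv]]]|vp].
  by rewrite in_carrier gt_eqF.
exists (carrier p); split=> //; first exact: carrier_simplex.
apply/open_simplexP; split; first exact: carrier_barycentric.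
move=> w; rewrite in_carrier lt_def => ->/=.
by have [+ _ _] := carrier_barycentric p; apply.
Qed.

Lemma realisation_open (U : set K) : open U = whitehead_open U.
Proof. by []. Qed.

Lemma image_point_of (P : set E) s : simplices Sigma s ->
  (point_of @` (point_of @^-1` P)) `&` simplex s = P `&` simplex s.
Proof.
move=> Ss; apply/seteqP; split=> [t [[p Pp <-] st]//|t [Pt st]]; split=> //.
have [|p pt] := @realisation_of t; first by exists s.
by exists p => //=; rewrite pt.
Qed.

Lemma point_of_continuous : continuous point_of.
Proof.
apply/continuousP => U oU; rewrite realisation_open => s Ss.
apply/open_subspaceP; exists U => //.
by rewrite -[RHS]setIA setIid -(image_point_of U Ss).
Qed.

Lemma open_star_open v : open (open_star v : set K).
Proof.
rewrite (_ : open_star v = (fun p => point_of p v : R) @^-1` [set x | x > 0]).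
  apply: open_comp; last exact: open_gt.
  move=> p _; apply: (@continuous_comp _ _ _ point_of (fun t : E => t v : R)).
    exact: point_of_continuous.
  exact: coord_cont.
apply/seteqP; split=> p /=.
  move/open_starP; rewrite in_carrier lt_def => ->/=.
  by have [+ _ _] := carrier_barycentric p; apply.
by move=> pv; apply/open_starP; rewrite in_carrier gt_eqF.
Qed.

Lemma realisation_hausdorff : hausdorff_space K.
Proof.
move=> p q pq; apply: point_of_inj; apply: norm_hausdorff => A B Ap Bq.
have [r [Ar Br]] := pq _ _ (point_of_continuous Ap) (point_of_continuous Bq).
by exists (point_of r).
Qed.

(** Openness is tested on one simplex at a time, where the sum involves finitely many coordinates;
    arbitrary, even unbounded, weights are therefore allowed. *)
Lemma weighted_sum_continuous (a : V -> R) :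
  continuous (fun p => \sum_(v <- carrier p) a v * point_of p v : R).
Proof.
apply/continuousP => U oU; rewrite realisation_open => s Ss.
apply/open_subspaceP.
exists ((fun t : E => \sum_(v <- s) a v * t v : R) @^-1` U).
  apply: open_comp => // t _; apply: continuous_big => [|v _].
    exact: add_continuous.
  move=> u; apply: (@continuousM _ _ (fun=> a v) (fun t : E => t v : R)).
    exact: cst_continuous.
  exact: coord_cont.
apply/seteqP; split=> t; last first.
  move=> [[[p Up <-] st] _]; split=> //=.
  by rewrite sum_carrier//; apply: carrier_sub; rewrite -simplexE.
move=> [Ut st]; do !split=> //.
have [|p pt] := @realisation_of t; first by exists s.
exists p => //=; rewrite -(@sum_carrier p s) ?pt//.
by apply: carrier_sub; rewrite -simplexE pt.
Qed.

(* Otherwise a weighted sum of the coordinates, continuous for the Whitehead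
   topology whatever the weights, would be unbounded on the compact set. *)
Lemma compact_finite_carrier (C : set K) : compact C ->
  finite_set [set v | exists2 p, C p & v \in carrier p].
Proof.
move=> cC; apply: contrapT => /infiniteP/card_leP[g].
pose f i : V := set_val (g (SigSub (mem_set (I : [set: nat] i)))).
have f_inj : injective f.
  move=> i j /val_inj gij; have := inj (f := g) (mem_set I) (mem_set I) gij.
  by move=> /(congr1 set_val).
have fP i : {p | C p /\ f i \in carrier p}.
  have : [set v | exists2 p, C p & v \in carrier p] (f i) by exact: set_valP.
  by move=> /cid2[p Cp fp]; exists p.
(* The weight of [f i] is [i] divided by the coordinate at [f i] of the chosen point of [C], so the
   weighted sum at that point is at least [i]. *)
pose a v : R := if pselect (exists i, f i = v) is left e
  then (sval (cid e))%:R / point_of (sval (fP (sval (cid e)))) v else 0.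
have aE i : a (f i) = i%:R / point_of (sval (fP i)) (f i).
  rewrite /a; case: pselect => [e|]; last by case; exists i.
  by case: (cid e) => j /= /f_inj->.
have a0 v : 0 <= a v.
  rewrite /a; case: pselect => // e; rewrite divr_ge0//.
  by case: (fP _) => p /= _; have [+ _ _] := carrier_barycentric p; apply.
pose G p := \sum_(v <- carrier p) a v * point_of p v.
have cG : compact (G @` C).
  apply: continuous_compact => //; apply: continuous_subspaceT.
  exact: weighted_sum_continuous.
have [M [_ MG]] := compact_bounded cG.
pose i := Num.bound (`|M| + 1).
have Mi : `|M| + 1 < i%:R by rewrite archi_boundP// addr_ge0.
have [Cp ip] := svalP (fP i); set p := sval (fP i) in Cp ip.
have MM : M < `|M| + 1 by rewrite (le_lt_trans (ler_norm M))// ltrDl.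
have Gp : `|G p| <= `|M| + 1 by apply: MG MM _ _; exists p.
have [p0 _ _] := carrier_barycentric p.
have : i%:R <= G p.
  rewrite /G (bigD1_seq (f i))//= aE -/p mulfVK; last by rewrite -in_carrier.
  by rewrite lerDl sumr_ge0// => v _; rewrite mulr_ge0.
by rewrite leNgt (le_lt_trans (le_trans (ler_norm _) Gp)).
Qed.

(** Within the finitely many simplices with vertices in [B], the complement of a Whitehead open set
    is a finite union of norm closed sets. So continuity for the norm is enough there. *)
Lemma realisation_within_continuous (T : topologicalType) (D : set T)
    (f : T -> K) (B : set V) : finite_set B ->
  (forall x, D x -> [set` carrier (f x)] `<=` B) ->
  {within D, continuous (point_of \o f)} -> {within D, continuous f}.
Proof.
move=> fB fDB /subspace_continuousP cf; apply/subspace_continuousP => x Dx W.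
rewrite nbhsE => -[U [oU Ux] UW].
pose S := [set s | simplices Sigma s /\ [set` s] `<=` B].
have fS : finite_set S.
  apply: (sub_finite_set (B := [set` fpowerset (fset_set B)])); last exact: finite_fset.
  move=> s [_ sB]; rewrite /= fpowersetE; apply/fsubsetP => v vs.
  by rewrite in_fset_set// inE; exact: sB.
pose C := \bigcup_(s in S) (simplex s `\` point_of @` U).
have cC : closed C.
  apply: closed_bigcup => // s [Ss _].
  have /open_subspaceP[G oO OU] := (oU : whitehead_open U) _ Ss.
  rewrite (_ : _ `\` _ = simplex s `&` ~` G).
    by apply: closedI; [exact: simplex_closed|exact: open_closedC].
  apply/seteqP; split=> t [st nt]; split=> //; apply: contra_not nt.
    by move=> Ot; have : (G `&` simplex s) t by []; rewrite OU => -[[]].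
  move=> Ut; have : ((point_of @` U `&` simplex s) `&` simplex s) t by [].
  by rewrite -OU => -[].
have nCx : ~ C (point_of (f x)).
  by move=> [s _ [_]]; apply; exists (f x).
have : nbhs x [set y | D y -> ~ C (point_of (f y))].
  exact: cf _ Dx _ (open_nbhs_nbhs (conj (closed_openC cC) nCx)).
suff : nbhs x [set y | D y -> ~ C (point_of (f y))] ->
  nbhs x [set y | D y -> W (f y)] by [].
apply: filterS => y nC Dy; apply: UW; apply: contrapT => nUy.
apply: (nC Dy); exists (carrier (f y)).
  by split; [exact: carrier_simplex|exact: fDB].
split; first by rewrite simplexE; exact: carrier_barycentric.
by move=> [q Uq /point_of_inj qf]; apply: nUy; rewrite -qf.
Qed.

End RealisationTopology.

(** * Canonical maps *)

Section BallInCone.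
Variables (R : realType) (m : nat).

Lemma sphereP (w : 'rV[R]_m.+1) : sphere w <-> enorm w = 1.
Proof.
rewrite /sphere/= -enorm_sq; split=> [/eqP|->]; last by rewrite expr1n.
by rewrite sqrp_eq1 ?enorm_ge0// => /eqP.
Qed.

Lemma cballP (w : 'rV[R]_m.+1) : cball w <-> enorm w <= 1.
Proof. by rewrite /cball/= -enorm_sq expr_le1// enorm_ge0. Qed.

Lemma sphere_compact : compact (@sphere R m).
Proof.
apply: bounded_closed_compact.
  exists 1; split=> // M M1 w w1; rewrite /= [leLHS]mx_normrE.
  apply: bigmax_le => [|[i j] _] /=; first by rewrite ltW// (lt_trans ltr01).
  rewrite ord1; apply: le_trans (ltW M1).
  rewrite -(@expr_le1 _ 2)// real_normK ?num_real//.
  have <- : \sum_(i < m.+1) w 0 i ^+ 2 = 1 := w1.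
  by rewrite (bigD1 j)//= lerDl sumr_ge0// => k _; exact: sqr_ge0.
rewrite (_ : @sphere R m = (@enorm R m.+1) @^-1` [set 1]); last first.
  by apply/seteqP; split=> w /sphereP.
by apply: preimage_closed => [w _|]; [exact: enorm_continuous|exact: closed_eq].
Qed.

Lemma normalize_sphere (w : 'rV[R]_m.+1) : w != 0 ->
  sphere ((enorm w)^-1 *: w).
Proof.
move=> w0; apply/sphereP; rewrite enormZ ?invr_ge0 ?enorm_ge0// mulVf//.
by apply: contra w0 => /eqP/enorm_eq0->.
Qed.

(* At w = 0 the junk value 0^-1 = 0 is harmless: the formula gives c. *)
Lemma cone_continuous (E : normedModType R) (c : E) (h : 'rV[R]_m.+1 -> E)
    (M : R) : {within @sphere R m, continuous h} ->
  (forall u, sphere u -> `|h u - c| <= M) ->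
  continuous (fun w => (1 - enorm w) *: c + enorm w *: h ((enorm w)^-1 *: w)).
Proof.
move=> ch hM w; have [->|w0] := eqVneq w 0; last first.
  have en0 : enorm w != 0 by apply: contra w0 => /eqP/enorm_eq0->.
  have cn : {within [set v | v != 0],
      continuous (fun v : 'rV[R]_m.+1 => (enorm v)^-1 *: v)}.
    apply: within_continuous_for => v v0.
    apply: (@continuousZ _ _ _ (fun v => (enorm v)^-1) id); last exact: cvg_id.
    apply: (@continuousV _ _ (@enorm R m.+1)); last exact: enorm_continuous.
    by apply: contra v0 => /eqP/enorm_eq0->.
  have chn : {within [set v | v != 0], continuous (fun v => h ((enorm v)^-1 *: v))}.
    apply: (within_continuous_compS cn _ ch) => _ [v v0 <-].
    exact: normalize_sphere.
  have ow : open [set v : 'rV[R]_m.+1 | v != 0].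
    rewrite (_ : [set v | _] = ~` [set 0]); last first.
      by apply/seteqP; split=> v /=; [move/eqP|move/eqP].
    exact/closed_openC/accessible_closed_set1/hausdorff_accessible/norm_hausdorff.
  have chw : {for w, continuous (fun v => h ((enorm v)^-1 *: v))}.
    move: chn; rewrite continuous_open_subspace// => /(_ w).
    by apply; rewrite inE.
  have chZ : {for w, continuous (fun v => enorm v *: h ((enorm v)^-1 *: v))}.
    by apply: continuousZ; [exact: enorm_continuous|exact: chw].
  apply: (@continuousD _ _ _ (fun v => (1 - enorm v) *: c)); last exact: chZ.
  apply: (@continuousZ _ _ _ (fun v => 1 - enorm v) (fun=> c)); last first.
    exact: cst_continuous.
  suff : {for w, continuous ((fun=> 1) - @enorm R m.+1)} by [].
  by apply: continuousB; [exact: cst_continuous|exact: enorm_continuous].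
have e0 := enorm0 R m.+1.
have M0 : 0 <= M := le_trans (normr_ge0 _) (hM _ (@sphere_delta R m)).
rewrite /continuous_at e0 subr0 scale1r scale0r addr0.
apply/(@cvgrPdist_lt _ _ _ (nbhs (0 : 'rV[R]_m.+1))) => e egt0.
have : \forall v \near (0 : 'rV[R]_m.+1), enorm v < e / (M + 1).
  have := @enorm_continuous R m.+1 0; rewrite /continuous_at e0 => /cvgr_lt; apply.
  by rewrite divr_gt0// ltr_wpDl.
apply: filterS => v ve.
rewrite scalerBl scale1r -addrA [- _ + _]addrC -scalerBr opprD addrA subrr sub0r normrN.
rewrite normrZ ger0_norm ?enorm_ge0//.
have [->|v0] := eqVneq v 0; first by rewrite e0 mul0r.
apply: (@le_lt_trans _ _ (enorm v * (M + 1))).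
  apply: ler_wpM2l; first exact: enorm_ge0.
  by apply: le_trans (hM _ (normalize_sphere v0)) _; rewrite lerDl.
by rewrite -ltr_pdivlMr// ltr_wpDl.
Qed.

End BallInCone.

Section CanonicalMaps.
Variables (R : realType) (X : topologicalType) (n : nat)
  (UU : nat -> set (set X)).
Hypothesis cUU : forall k, (k <= n)%N -> open_cover (UU k).
Local Notation K := (realisation R (Delta n UU)).

Definition star_values (k : nat) (x : X) : set K :=
  [set p | forall i, i \in carrier p -> (i.2 <= k)%N /\ i.1 x].

Lemma carrier_index (p : K) i : i \in carrier p -> index_set n UU i.
Proof. by move: i; have [[_ sub _] _] := carrier_simplex p; exact: sub. Qed.

Lemma coverP (k : nat) (x : X) : (k <= n)%N -> exists2 U, UU k U & U x.
Proof.
by move=> /cUU[_ cU]; have : [set: X] x by []; rewrite -cU => -[U ? ?]; exists U.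
Qed.

Lemma Delta_vertex (k : nat) (x : X) (U : set X) : (k <= n)%N -> UU k U -> U x ->
  simplices (Delta n UU) [fset (U, k)]%fset.
Proof.
move=> kn kU Ux; split; last first.
  by move=> i j; rewrite !inE => /eqP-> /eqP->.
split; first by apply/fset0Pn; exists (U, k); rewrite !inE.
  by move=> i /=; rewrite inE => /eqP->.
by exists x => i /=; rewrite inE => /eqP->.
Qed.

Lemma star_values_neq0 k : (k <= n)%N -> set_valued (star_values k).
Proof.
move=> kn x; have [U U0 Ux] := coverP x (leq0n n).
have Sv := Delta_vertex (leq0n n) U0 Ux.
have [|p pE] := @realisation_of R _ (Delta n UU) (vertex R (U, 0%N)).
  exists [fset (U, 0%N)]%fset => //; move=> A [_]; apply.
  by exists (U, 0%N) => //=; rewrite inE.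
exists p => i; rewrite in_carrier pE coord_vertex.
by have [->|_] := eqVneq i (U, 0%N); rewrite ?eqxx.
Qed.

(** By compactness only finitely many indices occur in carriers of points of [C], and inclusion of
    [C] in the value at [x] amounts to [x] lying in the corresponding open sets, besides bounds on
    the levels. *)
Lemma star_values_locally_constant k : lower_locally_constant (star_values k).
Proof.
move=> C /compact_finite_carrier fC; rewrite openE => x Cx.
have : \forall y \near x, forall i,
    [set i | exists2 p, C p & i \in carrier p] i -> i.1 y.
  apply: (@filter_forall_finite _ _ _ _ (fun (i : set X * nat) y => i.1 y)) => //.
  move=> i [p Cp ip]; have [i2 Ui] := carrier_index ip.
  apply: open_nbhs_nbhs; split; first by have [+ _] := cUU i2; apply.
  by have [] := Cx _ Cp _ ip.
apply: filterS => y yC p Cp i ip; split; last by apply: yC; exists p.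
by have [] := Cx _ Cp _ ip.
Qed.

(* Cone off from a vertex (U, k + 1) with x in U; compactness of the sphere
   confines the cone to a finite subcomplex. *)
Lemma star_values_aspherical : aspherical R n star_values.
Proof.
move=> k kn x f cf fS.
have [U UkU Ux] := coverP x kn; pose v0 : set X * nat := (U, k.+1).
pose c := vertex R v0; pose h w := point_of (f w).
pose G w := (1 - enorm w) *: c + enorm w *: h ((enorm w)^-1 *: w).
have fSx u : sphere u -> star_values k x (f u) by move=> Su; apply: fS; exists u.
have norm_point (p : K) : `|point_of p| = 1.
  have [p0 ps <-] := carrier_barycentric p.
  by rewrite (l1norm_seq ps); apply: eq_bigr => v _; rewrite ger0_norm.
have norm_c : `|c| = 1.
  rewrite (@l1norm_seq _ _ [fset v0]%fset) => [|v]; last first.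
    by rewrite inE coord_vertex => /negbTE->.
  by rewrite big_seq_fset1 coord_vertex eqxx normr1.
have cG : continuous G.
  apply: (@cone_continuous _ _ _ _ _ 2); last first.
    move=> u _; apply: le_trans (ler_normB _ _) _.
    by rewrite norm_point norm_c.
  move=> u; apply: continuous_comp; first exact: cf.
  exact: point_of_continuous.
(* The carriers of values of [f] use levels at most [k], so the vertex [v0] of level [k.+1] respects
   the rule of one vertex per level; [x] lies in the kernel of the enlarged simplex. *)
have cone u : sphere u -> simplices (Delta n UU) (v0 |` carrier (f u))%fset.
  move=> Su; have fu := fSx _ Su.
  have [[_ csub _] cinj] := carrier_simplex (f u).
  split; last first.
    move=> i j; rewrite !inE => /predU1P[->|ic] /predU1P[->|jc] //=.
    + by move=> jk; have [] := fu _ jc; rewrite -jk ltnn.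
    + by move=> ik; have [] := fu _ ic; rewrite ik ltnn.
    + exact: cinj.
  split.
  - by apply/fset0Pn; exists v0; rewrite !inE eqxx.
  - by move=> i /=; rewrite !inE => /predU1P[->//|]; exact: csub.
  - by exists x => i /=; rewrite !inE => /predU1P[->//|/fu[]].
have G_bary w : cball w -> w != 0 ->
    barycentric (v0 |` carrier (f ((enorm w)^-1 *: w)))%fset (G w).
  move=> /cballP w1 w0; set u := _ *: w.
  have Su : sphere u by exact: normalize_sphere.
  have [p0 ps p1] := carrier_barycentric (f u).
  have v0u : v0 \notin carrier (f u).
    by apply/negP => /(fSx _ Su)[]; rewrite ltnn.
  split=> [v|v|].
  - rewrite coordD !coordZ; apply: addr_ge0; apply: mulr_ge0.
    + by rewrite subr_ge0.
    + exact: ler0n.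
    + exact: enorm_ge0.
    + exact: p0.
  - rewrite !inE negb_or => /andP[vv0 /ps vu].
    by rewrite coordD !coordZ coord_vertex (negbTE vv0) /h vu !mulr0 addr0.
  - rewrite big_fsetU1// coordD !coordZ coord_vertex eqxx mulr1 /h.
    rewrite [point_of (f u) v0]ps// mulr0 addr0.
    rewrite (eq_big_seq (fun v => enorm w * point_of (f u) v)) => [|v vu].
      by rewrite -mulr_sumr p1 mulr1; exact: subrK.
    rewrite coordD !coordZ coord_vertex; have [vv0|_] := eqVneq v v0.
      by rewrite vv0 (negbTE v0u) in vu.
    by rewrite mulr0 add0r.
have G0 : G 0 = c by rewrite /G enorm0 subr0 scale1r scale0r addr0.
have G_poly w : cball w -> polyhedron (Delta n UU) (G w).
  move=> Bw; have [->|w0] := eqVneq w 0.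
    rewrite G0; exists [fset v0]%fset; first exact: Delta_vertex kn UkU Ux.
    by move=> A [_]; apply; exists v0 => //=; rewrite inE.
  exists (v0 |` carrier (f ((enorm w)^-1 *: w)))%fset.
    exact/cone/normalize_sphere.
  by rewrite simplexE; exact: G_bary.
have [g gP] : {g : 'rV[R]_k.+1 -> K | forall w, cball w -> point_of (g w) = G w}.
  suff : forall w, {p : K | cball w -> point_of p = G w}.
    by move=> q; exists (fun w => sval (q w)) => w; case: (q w).
  move=> w; have [Bw|nBw] := pselect (cball w); last by exists (f w).
  by have /cid[p pE] := realisation_of (G_poly _ Bw); exists p.
have carrier_g w i : cball w -> i \in carrier (g w) ->
    i = v0 \/ exists2 u, sphere u & i \in carrier (f u).
  move=> Bw; rewrite in_carrier (gP _ Bw).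
  have [->|w0] := eqVneq w 0.
    rewrite G0 coord_vertex.
    by have [->|_] := eqVneq i v0; [left|rewrite eqxx].
  have [_ Gs _] := G_bary _ Bw w0 => Gi.
  have : i \in (v0 |` carrier (f ((enorm w)^-1 *: w)))%fset.
    by apply: contraNT Gi => /Gs ->.
  rewrite !inE => /predU1P[|iu]; [by left|right].
  by exists ((enorm w)^-1 *: w) => //; exact: normalize_sphere.
exists g; split.
- have fin := compact_finite_carrier (continuous_compact cf (@sphere_compact R k)).
  apply: (@realisation_within_continuous _ _ _ _ _ _ (v0 |`
      [set v | exists2 p, (f @` @sphere R k) p & v \in carrier p])).
  + by rewrite finite_setU; split => //; exact: finite_set1.
  + move=> w Bw i /(carrier_g _ _ Bw)[->|[u Su iu]]; first by left.
    by right; exists (f u) => //; exists u.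
  + apply: (@within_continuous_eq _ _ _ G); first by move=> w /gP.
    exact: continuous_subspaceT.
- move=> _ [w Bw <-] i /(carrier_g _ _ Bw)[->//|[u Su iu]].
  by have [ik ix] := fSx _ Su _ iu; split=> //; exact: leqW.
- move=> u Su; apply: point_of_inj; have /sphereP u1 := Su.
  rewrite gP; last by apply/cballP; rewrite u1.
  by rewrite /G u1 subrr scale0r add0r scale1r invr1 scale1r.
Qed.

Lemma star_selection_canonical (f : X -> K) :
  continuous f -> selection (star_values n) f -> canonical_map f.
Proof.
move=> cf sf; split=> // i _ x /open_starP ix.
by have [] := sf x _ ix.
Qed.

End CanonicalMaps.

(** For the constant sequence, the preimages of the open stars refine [CC]. A point lies in the
    stars of the vertices of the carrier of its image only, and these have distinct levels among
    [0, ..., n], so the order is at most [n]. *)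
Lemma canonical_map_dim (R : realType) (X : topologicalType) (n : nat) :
  (forall UU : nat -> set (set X), (forall k, (k <= n)%N -> open_cover (UU k)) ->
    exists f : X -> realisation R (Delta n UU), canonical_map f) -> dim_le X n.
Proof.
move=> canon CC cCC fCC.
have [//|f [cf fU]] := canon (fun=> CC).
pose J := [set i | simplices (Delta n (fun=> CC)) [fset i]%fset].
pose D i := f @^-1` open_star i.
have carrierJ x i : i \in carrier (f x) -> J i.
  move=> ix; apply: simplex_sub (carrier_simplex (f x)) _ _.
    by apply/fset0Pn; exists i; rewrite inE.
  by rewrite fsub1set.
have Jindex i : J i -> CC i.1 /\ (i.2 < n.+1)%N.
  by move=> [[_ /(_ i)]]; rewrite /= inE eqxx => /(_ isT)[].
exists (D @` J); split.
- split.
    move=> _ [i _ <-]; apply: open_comp; last exact: open_star_open.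
    by move=> x _; exact: cf.
  apply/seteqP; split=> // x _.
  have [i ix] : exists i, i \in carrier (f x).
    by apply/fset0Pn; exact: simplex_neq0 (carrier_simplex _).
  by exists (D i); [exists i => //; exact: carrierJ ix|exact/open_starP].
- apply: finite_image; apply: (sub_finite_set (B := CC `*` `I_n.+1)).
    by move=> i /Jindex.
  by apply: finite_setX => //; exact: finite_II.
- by move=> _ [i Ji <-]; exists i.1; [have [] := Jindex _ Ji|exact: fU].
- move=> x; apply: (@card_le_trans _ _ _ [set` carrier (f x)]).
    apply: (card_le_trans _ (card_image_le D _)).
    apply: subset_card_le => _ [[i _ <-] /open_starP ix].
    by exists i.
  have [_ sinj] := carrier_simplex (f x).
  have card_snd : snd @` [set` carrier (f x)] #= [set` carrier (f x)].
    by apply: inj_card_eq => i j /set_mem ix /set_mem jx; exact: sinj.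
  rewrite -(card_le_eql card_snd).
  by apply: subset_card_le => _ [i /carrierJ/Jindex[_ ?] <-].
Qed.

Theorem corollary6p5 (R : realType) (X : topologicalType) (n : nat)
    (hX : hausdorff_space X) (pX : paracompact X) :
  [<->
    dim_le X n;
    forall (Y : topologicalType) (phi : nat -> X -> set Y),
      hausdorff_space Y ->
      (forall k, (k <= n)%N -> set_valued (phi k)) ->
      (forall k, (k <= n)%N -> lower_locally_constant (phi k)) ->
      aspherical R n phi ->
      exists f : X -> Y, continuous f /\ selection (phi n) f;
    forall UU : nat -> set (set X),
      (forall k, (k <= n)%N -> open_cover (UU k)) ->
      exists f : X -> realisation R (Delta n UU), canonical_map f ].
Proof.
tfae.
- by move=> dX Y phi _; exact: dim_selection.
- move=> sel UU cUU.
  have [||||f [cf sf]] := sel (realisation R (Delta n UU)) (@star_values R X n UU).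
  - exact: realisation_hausdorff.
  - by move=> k; exact: (star_values_neq0 R cUU).
  - by move=> k _; exact: star_values_locally_constant cUU k.
  - exact: star_values_aspherical cUU.
  - by exists f; exact: star_selection_canonical.
- exact: canonical_map_dim.
Qed.
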